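(* Let $N\ge1$ be an integer and $Y=(y_1>y_2>\cdots>y_N)$ integers. Let $(G_k)_{k\ge0}$ be the geometric random walk on $\mathbb Z$ with transition probability $$\mathbb P(G_{k+1}=x\mid G_k=y)=\frac{1}{2^{y-x}}\mathbf 1_{x<y},$$ and let $\tau=\min\{m\ge0: G_m>y_{m+1}\}$ be its hitting time of the strict epigraph of $Y$. Then the function $$\mathrm{ch}_Y(v,u):=\sum_{z\in\mathbb Z}(2u+2)^z\cdot\mathbb E_{G_0=z}\left[\frac{2}{(2v+2)^{G_\tau+1}}\cdot\left(\frac{-v}{v+1}\right)^{\tau}\mathbf 1_{\tau<N}\right]$$ is a characteristic function of $Y$.
   Context: Let $\Omega_{\mathrm L}=\{w\in\mathbb C:|w+1|<\tfrac12\}$ and $\Omega_{\mathrm R}=\{w\in\mathbb C:|w|<\tfrac12\}$. For $Y=(y_1>\cdots>y_N)$, a function $\mathrm{ch}_Y$ is called a *characteristic function of $Y$* if: 1. $\mathrm{ch}_Y:\Omega_{\mathrm R}\times(\Omega_{\mathrm L}\setminus\{-1\})\to\mathbb C$ is analytic (in $(v,u)$, $v\in\Omega_{\mathrm R}$, $u\in\Omega_{\mathrm L}\setminus\{-1\}$); 2. for every $1\le i\le N$ (and every $u\in\Omega_{\mathrm L}\setminus\{-1\}$), $$\oint_0 v^{-i}(v+1)^{y_i+i}\,\mathrm{ch}_Y(v,u)\frac{\mathrm dv}{2\pi\mathrm i}=-u^{-i}(u+1)^{y_i+i},$$ where $\oint_0$ is over a small counterclockwise circle around $0$ contained in $\Omega_{\mathrm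 R}$. In the definition of $\tau$ only $m\in\{0,\dots,N-1\}$ matter; the event $\tau<N$ means that $G_m>y_{m+1}$ for some $0\le m\le N-1$. *)

(* Defs.v *)
From HB Require Import structures.
From mathcomp Require Import all_boot all_order all_algebra complex.
From mathcomp Require Import all_classical all_reals all_analysis.
From mathcomp.analysis.showcase Require summability.

Set Implicit Arguments.
Unset Strict Implicit.
Unset Printing Implicit Defensive.

Import numFieldNormedType.Exports.
Import Order.TTheory GRing.Theory Num.Theory.

Local Open Scope classical_set_scope.
Local Open Scope ring_scope.
Local Open Scope complex_scope.

Section UnconditionalSums.
Variables (R : realType) (I : choiceType).
Implicit Type x : I -> R[i].

(* Convergence along the directed set of finite subsets of [I].  The topology
   of [R[i]] is the one carried by its regular-module alias [R[i]^o]. *)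
Definition csum_to x (s : R[i]) : Prop :=
  @summability.partial_sum I R[i]^o x @ @summability.totally I --> (s : R[i]^o).

Definition csummable x : Prop := exists s, csum_to x s.

Definition csum x : R[i] := @summability.sum I _ R[i]^o x.

End UnconditionalSums.

Section ComplexAnalysis.
Variable R : realType.
Implicit Types (D : set (R[i] * R[i])) (v u w : R[i]).

(* On an open set [D]: near each point of [D], [f] is the sum of a convergent
   double power series.  The radius [r] may be taken small enough for the
   bidisc to be contained in [D]. *)
Definition analytic2_on D (f : R[i] -> R[i] -> R[i]) : Prop :=
  forall v0 u0, D (v0, u0) ->
  exists (a : nat -> nat -> R[i]) (r : R), 0 < r /\
    forall v u, `|v - v0| < r%:C -> `|u - u0| < r%:C ->
      csum_to (fun jk : nat * nat =>
        a jk.1 jk.2 * (v - v0) ^+ jk.1 * (u - u0) ^+ jk.2) (f v u).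

Definition ci : R[i] := 0 +i* 1.

Definition cexpi (t : R) : R[i] := cos t +i* sin t.

Definition circle_integral (f : R[i] -> R[i]) (c : R[i]) (r : R) : R[i] :=
  let g t := f (c + r%:C * cexpi t) * (ci * r%:C * cexpi t) in
  (\int[lebesgue_measure]_(t in `[0%R, 2 * pi]) complex.Re (g t))
  +i* (\int[lebesgue_measure]_(t in `[0%R, 2 * pi]) complex.Im (g t)).

Definition OmegaL : set R[i] := [set w | `|w + 1| < 2^-1].
Definition OmegaR : set R[i] := [set w | `|w| < 2^-1].

Definition ch_domain : set (R[i] * R[i]) := OmegaR `*` (OmegaL `\ (-1)).

(* The indices are shifted: [Y i] is y_{i+1}.  [ch] is a total function of which
   only the restriction to [ch_domain] matters.  Every circle around 0 contained
   in [OmegaR] is considered. *)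
Definition characteristic_function (N : nat) (Y : 'I_N -> int)
    (ch : R[i] -> R[i] -> R[i]) : Prop :=
  analytic2_on ch_domain ch /\
  forall (i : 'I_N) u, OmegaL u -> u != -1 ->
  forall r : R, 0 < r < 2^-1 ->
    circle_integral
      (fun v => v ^ (- i.+1%:Z) * (v + 1) ^ (Y i + i.+1%:Z) * ch v u) 0 r
      / (2 * pi%:C * ci)
    = - (u ^ (- i.+1%:Z) * (u + 1) ^ (Y i + i.+1%:Z)).

End ComplexAnalysis.

Section GeometricWalk.
Variables (R : realType) (d : measure_display) (T : measurableType d).
Implicit Types (P : probability T R) (G : nat -> T -> int) (X : T -> R[i]).

Definition geom_step (y x : int) : R :=
  if x < y then (2 ^ (y - x))^-1 else 0.

(* Under [P], [G] is the Markov chain started from [z] with transition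
   probabilities [geom_step]; the Markov property is written multiplied out, so
   that no conditioning on null events occurs. *)
Definition geometric_walk P G (z : int) : Prop :=
  [/\ forall k x, measurable [set w | G k w = x],
      P [set w | G 0%N w = z] = 1%E &
      forall (k : nat) (x : nat -> int),
        (P [set w | forall j, (j <= k.+1)%N -> G j w = x j] =
         P [set w | forall j, (j <= k)%N -> G j w = x j]
         * (geom_step (x k) (x k.+1))%:E)%E].

Definition cintegrable P X : Prop :=
  P.-integrable setT (fun w => (complex.Re (X w))%:E) /\
  P.-integrable setT (fun w => (complex.Im (X w))%:E).

Definition cexpectation P X : R[i] :=
  fine 'E_P[fun w => complex.Re (X w)] +i* fine 'E_P[fun w => complex.Im (X w)].

(* The least [m < N] with [g m > y_{m+1}], and [N] when there is none. *)
Definition hitting_time (N : nat) (Y : 'I_N -> int) (g : nat -> int) : nat :=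
  \big[minn/N]_(m < N | Y m < g m) m.

Definition ch_payoff (N : nat) (Y : 'I_N -> int) G (v : R[i]) (w : T) : R[i] :=
  let tau := hitting_time Y (fun k => G k w) in
  2 / (2 * v + 2) ^ (G tau w + 1) * (- v / (v + 1)) ^+ tau * (tau < N)%:R.

Definition ch_term (N : nat) (Y : 'I_N -> int) (P : int -> probability T R) G
    (v u : R[i]) (z : int) : R[i] :=
  (2 * u + 2) ^ z * cexpectation (P z) (ch_payoff Y G v).

Definition ch_walk (N : nat) (Y : 'I_N -> int) (P : int -> probability T R) G
    (v u : R[i]) : R[i] :=
  csum (ch_term Y P G v u).

End GeometricWalk.

(* Main.v *)
(** A hit at time [m] happens above [y_{m+1} >= y_N], and the walk decreases, so
    only finitely many values [(m, x)] of [(tau, G_tau)] contribute to the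
    expectation from [z].  Starting points [z > y_1] give [tau = 0] and a geometric
    series; hence on the domain [ch] equals
      [sum_(y_N < z <= y_1) (2u+2)^z E_z(v)
         + ((u+1)/(v+1))^(y_1+1) / (v - u)],
    a rational function without poles there, which is expanded in double power
    series.

    For the contour identity put [k = i - 1].  The integral of
    [v^(-i) (v+1)^(y_i+i)] against the payoff at [(m, x)] vanishes for [m > k] and
    is [(-1)^k 2^(-x) C(x - y_i - 1, k - m)] for [m <= k], [x > y_i].  Extended by
    [0] to [x <= y_i], these numbers satisfy the backward equation of the walk (the
    hockey-stick identity), and at time [k] they vanish off the epigraph; optional
    stopping evaluates the integral of [E_z] to
    [(-1)^k 2^(-z) C(z - y_i - 1, k) 1(z > y_i)].  The sum over [z] then telescopes
    against the integral of the tail term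
    [((u+1)/(v+1))^(y_1+1) / (v - u)], leaving [- u^(-i) (u+1)^(y_i+i)]. *)

Require Import Defs.
From mathcomp Require Import all_boot all_order all_algebra complex finmap.
From mathcomp Require Import all_classical all_reals all_analysis.
From mathcomp Require Import measurable_realfun.
From mathcomp Require Import ring lra zify.
From mathcomp.analysis.showcase Require summability.
Import Order.TTheory GRing.Theory Num.Theory.
Import numFieldNormedType.Exports.
Import ComplexField.Normc.
Local Open Scope classical_set_scope.
Local Open Scope ring_scope.
Local Open Scope complex_scope.

Set Implicit Arguments.
Unset Strict Implicit.
Unset Printing Implicit Defensive.

(** * Unconditional sums *)

Section Summability.
Variable R : realType.
Implicit Types (I J K : choiceType).

Lemma normc_ge0 (z : R[i]) : 0 <= normc z.
Proof. by case: z => a b /=; exact: sqrtr_ge0. Qed.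

Lemma normE (z : R[i]) : `|z| = (normc z)%:C.
Proof. by []. Qed.

Lemma normc_real (x : R) : normc x%:C = `|x|.
Proof. by rewrite /= expr0n addr0 sqrtr_sqr. Qed.

Lemma normcX (z : R[i]) n : normc (z ^+ n) = normc z ^+ n.
Proof. by elim: n => [|n ih]; rewrite ?expr0 ?normc1 // !exprS normcM ih. Qed.

Lemma normc_sum I (r : seq I) (F : I -> R[i]) :
  normc (\sum_(i <- r) F i) <= \sum_(i <- r) normc (F i).
Proof.
elim/big_ind2: _ => //; first by rewrite normc0.
by move=> a b c e ab ce; apply: le_trans (le_normcD _ _) (lerD ab ce).
Qed.

Lemma csum_toP I (x : I -> R[i]) (s : R[i]) :
  csum_to x s <-> forall e : R, 0 < e -> exists A : {fset I},
    forall B : {fset I}, (A `<=` B)%fset -> normc (s - \sum_(i <- B) x i) < e.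
Proof.
have psE (B : {fset I}) :
    @summability.partial_sum I R[i]^o x B = \sum_(i <- B) x i.
  by rewrite big_seq_fsetE.
rewrite /csum_to; split.
- move=> /(cvgrPdist_lt (FF := @summability.totally_filter I)) h e e0.
  have e0' : 0 < e%:C :> R[i] by rewrite ltcR.
  have [A _ hA] := h _ e0'.
  exists A => B AB; rewrite -ltcR -normE -psE; exact: hA.
- move=> h; apply/(cvgrPdist_lt (FF := @summability.totally_filter I)) => e e0.
  (* A positive element of [R[i]] has zero imaginary part, so the complex tolerance of the norm
     topology is a real number in disguise. *)
  have eE : e = (complex.Re e)%:C by rewrite RRe_real// gtr0_real.
  have e0' : 0 < complex.Re e by rewrite -ltcR -eE.
  have [A hA] := h _ e0'.
  exists A => // B AB /=.
  by rewrite psE normE eE ltcR; exact: hA.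
Qed.

Lemma csum_eq I (x : I -> R[i]) (s : R[i]) : csum_to x s -> csum x = s.
Proof.
move=> xs; rewrite /csum /summability.sum.
exact: (cvg_lim (@norm_hausdorff _ _) (FF := @summability.totally_filter I) xs).
Qed.

Definition abs_bounded I (x : I -> R[i]) :=
  exists M : R, forall A : {fset I}, \sum_(i <- A) normc (x i) <= M.

(** Absolute boundedness travels with the value, so that products and regroupings can use it without
    deriving it again from unconditional convergence. *)
Definition abs_sum_to I (x : I -> R[i]) (s : R[i]) :=
  abs_bounded x /\ csum_to x s.

Lemma sum_fset_split I (V : nmodType) (A B : {fset I}) (F : I -> V) : (A `<=` B)%fset ->
  \sum_(i <- B) F i = \sum_(i <- A) F i + \sum_(i <- (B `\` A)%fset) F i.
Proof.
move=> AB; rewrite (big_fsetID _ (mem A)) /=; congr (_ + _).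
  apply: eq_fbigl => i; rewrite !inE /=.
  by rewrite andb_idl// => /(fsubsetP AB).
by apply: eq_fbigl => i; rewrite !inE /= andbC.
Qed.

Lemma ler_sum_fset I (A B : {fset I}) (F : I -> R) : (forall i, 0 <= F i) ->
  (A `<=` B)%fset -> \sum_(i <- A) F i <= \sum_(i <- B) F i.
Proof.
by move=> F0 AB; rewrite (sum_fset_split F AB) lerDl sumr_ge0.
Qed.

(* A finite set [A0] almost exhausting the supremum of the absolute sums controls
   the difference of any two finite sums over supersets of [A0]. *)
Lemma csum_to_cofinal I (x : I -> R[i]) (s : R[i]) : abs_bounded x ->
  (forall (A : {fset I}) (e : R), 0 < e -> exists2 B : {fset I}, (A `<=` B)%fset &
     normc (s - \sum_(i <- B) x i) < e) ->
  csum_to x s.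
Proof.
move=> [M hM] h; apply/csum_toP => e e0.
pose E := [set t | exists A : {fset I}, t = \sum_(i <- A) normc (x i)].
have supE : has_sup E.
  split; first by exists (\sum_(i <- fset0) normc (x i)); exists fset0.
  by exists M => _ [A ->].
have e3 : 0 < e / 3 by lra.
have [_ [A0 ->] hA0] := sup_adherent e3 supE.
have tail (B : {fset I}) : (A0 `<=` B)%fset ->
    \sum_(i <- (B `\` A0)%fset) normc (x i) < e / 3.
  move=> AB; have : \sum_(i <- B) normc (x i) <= sup E.
    by apply: sup_upper_bound => //; exists B.
  by rewrite (sum_fset_split _ AB); lra.
have [C A0C hC] := h A0 _ e3.
exists A0 => B A0B.
have -> : s - \sum_(i <- B) x i = (s - \sum_(i <- C) x i) +
   (\sum_(i <- (C `\` A0)%fset) x i - \sum_(i <- (B `\` A0)%fset) x i).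
  by rewrite (sum_fset_split x A0B) (sum_fset_split x A0C); ring.
apply: le_lt_trans (le_normcD _ _) _.
have := le_normcD (\sum_(i <- (C `\` A0)%fset) x i)
   (- \sum_(i <- (B `\` A0)%fset) x i).
rewrite normcN.
have := normc_sum (C `\` A0)%fset x; have := normc_sum (B `\` A0)%fset x.
have := tail _ A0B; have := tail _ A0C.
lra.
Qed.

Lemma abs_sum_to_finite I (A : {fset I}) (x : I -> R[i]) :
  (forall i, i \notin A -> x i = 0) -> abs_sum_to x (\sum_(i <- A) x i).
Proof.
move=> x0; split.
  exists (\sum_(i <- A) normc (x i)) => B.
  have -> : \sum_(i <- A) normc (x i) = \sum_(i <- (A `|` B)%fset) normc (x i).
    by apply: big_fset_incl; [exact: fsubsetUl|move=> i _ /x0 ->; rewrite normc0].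
  by apply: ler_sum_fset; [move=> i; exact: normc_ge0|exact: fsubsetUr].
apply/csum_toP => e e0; exists A => B AB.
rewrite (big_fset_incl _ AB) ?subrr ?normc0// => i _ /x0 //.
Qed.

Lemma abs_sum_to_add I (x y : I -> R[i]) (s t : R[i]) : abs_sum_to x s -> abs_sum_to y t ->
  abs_sum_to (fun i => x i + y i) (s + t).
Proof.
move=> [[M hM] xs] [[M' hM'] yt]; split.
  exists (M + M') => A; apply: le_trans (lerD (hM A) (hM' A)).
  by rewrite -big_split/=; apply: ler_sum => i _; exact: le_normcD.
apply/csum_toP => e e0; have e2 : 0 < e / 2 by lra.
have [A hA] := (csum_toP x s).1 xs _ e2.
have [A' hA'] := (csum_toP y t).1 yt _ e2.
exists (A `|` A')%fset => B; rewrite fsubUset => /andP[AB A'B].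
rewrite big_split/= opprD addrACA; apply: le_lt_trans (le_normcD _ _) _.
by have := hA _ AB; have := hA' _ A'B; lra.
Qed.

(** Over a box the finite sum factors, and every finite set of pairs lies in the box of its two
    projections. Boxes are thus cofinal, and [csum_to_cofinal] reduces the claim to them. *)
Lemma abs_sum_to_mul I J (x : I -> R[i]) (y : J -> R[i]) (s t : R[i]) :
  abs_sum_to x s -> abs_sum_to y t ->
  abs_sum_to (fun ij : I * J => x ij.1 * y ij.2) (s * t).
Proof.
have sumX (V : pzRingType) (A : {fset I}) (B : {fset J}) (f : I -> V) (g : J -> V) :
    \sum_(p <- (A `*` B)%fset) f p.1 * g p.2 =
    (\sum_(i <- A) f i) * (\sum_(j <- B) g j).
  rewrite mulr_suml; under [RHS]eq_bigr do rewrite mulr_sumr.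
  rewrite pair_big_dep_cond; apply: eq_fbigl => -[i j].
  rewrite in_fsetM /=; apply/andP/imfset2P => [[iA jB]|].
    by exists i; rewrite ?inE ?andbT//; exists j; rewrite ?inE ?andbT.
  by move=> [i']; rewrite !inE andbT => iA [j']; rewrite !inE andbT => jB [-> ->].
have sub (A : {fset I * J}) :
    (A `<=` [fset p.1 | p in A] `*` [fset p.2 | p in A])%fset.
  by apply/fsubsetP => p pA; rewrite in_fsetM; apply/andP; split; apply/imfsetP; exists p.
move=> [[M hM] xs] [[M' hM'] yt].
have M'0 : 0 <= M' by have := hM' fset0; rewrite big_nil.
have bnd : abs_bounded (fun ij : I * J => x ij.1 * y ij.2).
  exists (M * M') => A.
  apply: le_trans (ler_sum_fset _ (sub A)) _; first by move=> i; exact: normc_ge0.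
  under eq_bigr do rewrite normcM.
  rewrite (sumX _ _ _ (fun i => normc (x i)) (fun j => normc (y j))).
  by apply: ler_pM => //; apply: sumr_ge0 => i _; exact: normc_ge0.
split=> //; apply: csum_to_cofinal => // A e e0.
have d0 : 0 < normc s + M' + 1 by rewrite ltr_wpDl// addr_ge0// normc_ge0.
(* Chosen so that [normc s * dl + dl * M' < e]; the [+ 1] makes the denominator positive and the
   inequality strict. *)
pose dl := e / (normc s + M' + 1).
have dl0 : 0 < dl by rewrite divr_gt0.
have [A1 hA1] := (csum_toP x s).1 xs _ dl0.
have [A2 hA2] := (csum_toP y t).1 yt _ dl0.
exists ((A1 `|` [fset p.1 | p in A]) `*` (A2 `|` [fset p.2 | p in A]))%fset.
  apply: fsubset_trans (sub A) _; apply/fsubsetP => p.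
  by rewrite !inE => /andP[-> ->]; rewrite !orbT.
rewrite (sumX _ _ _ x y).
have := hA1 _ (fsubsetUl A1 [fset p.1 | p in A]%fset).
have := hA2 _ (fsubsetUl A2 [fset p.2 | p in A]%fset).
have := le_trans (normc_sum _ y) (hM' (A2 `|` [fset p.2 | p in A])%fset).
set b := \sum_(_ <- _) y _; set a := \sum_(_ <- _) x _ => bM tb sa.
have -> : s * t - a * b = s * (t - b) + (s - a) * b by ring.
apply: le_lt_trans (le_normcD _ _) _; rewrite !normcM.
apply: (@le_lt_trans _ _ (normc s * dl + dl * M')).
  by apply: lerD; apply: ler_pM; rewrite ?normc_ge0// ltW.
rewrite /dl -[ltRHS](@divfK _ (normc s + M' + 1)) ?gt_eqF//.
rewrite -/dl mulrC -mulrDr ltr_pM2l//; lra.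
Qed.

(** Regrouping along a map with finite fibres. A finite sum of fibre sums is a single sum over the
    preimage, and the preimage of a set containing [h(A)] contains [A]. *)
Lemma abs_sum_to_fibers I J (x : I -> R[i]) (s : R[i]) (h : I -> J) (fib : J -> {fset I}) :
  (forall i j, (i \in fib j) = (h i == j)) -> abs_sum_to x s ->
  abs_sum_to (fun j => \sum_(i <- fib j) x i) s.
Proof.
move=> fibE [[M hM] xs].
have sumfib (V : nmodType) (A : {fset J}) (f : I -> V) :
    exists2 B : {fset I}, (forall i, (i \in B) = (h i \in A)) &
    \sum_(j <- A) \sum_(i <- fib j) f i = \sum_(i <- B) f i.
  pose B := (\bigcup_(j <- A) fib j)%fset.
  have BE i : (i \in B) = (h i \in A).
    apply/bigfcupP/idP => [[j]|hA].
      by rewrite andbT => jA; rewrite fibE => /eqP ->.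
    by exists (h i); rewrite ?hA// fibE.
  exists B => //; rewrite (partition_big_imfset _ h B).
  have sub : ([fset h i | i in B] `<=` A)%fset.
    by apply/fsubsetP => j /imfsetP[i /= iB ->]; rewrite -BE.
  rewrite -(big_fset_incl _ sub) => [|j jA jN].
    apply: eq_big_seq => j jB; rewrite big_fset_condE.
    apply: eq_fbigl => i; rewrite fibE !inE /= BE.
    rewrite andb_idl// => /eqP ->; exact: (fsubsetP sub).
  rewrite big_seq big1// => i; rewrite fibE => /eqP hi.
  by move: jN; rewrite -hi in_imfset//= BE hi.
split.
  exists M => A; have [B _ BE] := sumfib _ A (fun i => normc (x i)).
  apply: le_trans (hM B); rewrite -BE; apply: ler_sum => j _; exact: normc_sum.
apply/csum_toP => e /((csum_toP x s).1 xs)[A hA].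
exists [fset h i | i in A]%fset => B AB.
have [C CE ->] := sumfib _ B x; apply: hA.
by apply/fsubsetP => i iA; rewrite CE; apply: (fsubsetP AB); rewrite in_imfset.
Qed.
End Summability.

(** * Double power series *)

Lemma fset_segments :
  exists box : nat -> {fset nat}, forall n i, (i \in box n) = (i <= n)%N.
Proof.
exists (fun n => [fset i in iota 0 n.+1]%fset) => n i.
by rewrite in_fset -[LHS]/(i \in iota 0 n.+1) mem_iota.
Qed.

Section Analytic.
Variable R : realType.
Implicit Types (f g : R[i] -> R[i] -> R[i]) (v u : R[i]).

Lemma expr_lt_eventually (x e : R) : 0 <= x < 1 -> 0 < e ->
  exists n0, forall n, (n0 <= n)%N -> x ^+ n < e.
Proof.
move=> /andP[x0 x1] e0.
have x1' : `|x| < 1 by rewrite ger0_norm.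
have [n0 _ h] := (cvgrPdist_lt _ _).1 (cvg_expr x1') _ e0.
exists n0 => n /h /=; rewrite sub0r normrN ger0_norm// exprn_ge0//.
Qed.

Lemma sum_expr_le (x : R) n : 0 <= x < 1 -> \sum_(i < n) x ^+ i <= (1 - x)^-1.
Proof.
move=> /andP[x0 x1]; have x1' : 0 < 1 - x by rewrite subr_gt0.
rewrite -(@ler_pM2l _ (1 - x))// mulfV ?gt_eqF// -opprB mulNr -subrX1 opprB.
by rewrite gerBl exprn_ge0.
Qed.

Lemma expr_sum_inv (F : fieldType) (z : F) n : z != 1 ->
  (1 - z)^-1 - \sum_(i < n) z ^+ i = z ^+ n / (1 - z).
Proof.
rewrite -subr_eq0 => z1; have z1' : 1 - z != 0 by rewrite -opprB oppr_eq0.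
set S := \sum_(_ < _) _.
have -> : z ^+ n = 1 + (z - 1) * S by rewrite -subrX1 addrC subrK.
by field.
Qed.

(** The exponent pairs of total degree below [n], listed degree by degree so that each row is one
    binomial expansion. *)
Definition triangle n : {fset nat * nat} :=
  [fset x in [seq (m - j, j)%N | m <- index_iota 0 n, j <- index_iota 0 m.+1]]%fset.

Lemma in_triangle n (x : nat * nat) : (x \in triangle n) = (x.1 + x.2 < n)%N.
Proof.
rewrite inE; apply/(@allpairsPdep _ (fun=> nat))/idP => [[m [j]]|h].
  by rewrite !mem_index_iota => -[mn jm ->] /=; lia.
exists (x.1 + x.2)%N, x.2; rewrite !mem_index_iota; split; [lia|lia|].
by case: x h => a b /= _; rewrite addnK.
Qed.

Lemma sum_triangle (S : comPzRingType) (x y : S) n :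
  \sum_(p <- triangle n) x ^+ p.1 * y ^+ p.2 *+ 'C(p.1 + p.2, p.2) =
  \sum_(m < n) (x + y) ^+ m.
Proof.
pose L := [seq (m - j, j)%N | m <- index_iota 0 n, j <- index_iota 0 m.+1].
have uL : uniq L.
  apply: (@allpairs_uniq_dep _ (fun=> nat)); [exact: iota_uniq|by move=> *; exact: iota_uniq|].
  move=> [m j] [m' j'] /(@allpairsPdep _ (fun=> nat))[m0 [j0 []]]; rewrite !mem_index_iota => _ h.
  move=> [? ?]; subst m0 j0.
  move=> /(@allpairsPdep _ (fun=> nat))[m0 [j0 []]]; rewrite !mem_index_iota => _ h'.
  by move=> [? ?] [? ?]; subst; congr existT; lia.
have memL : triangle n =i L by move=> p; rewrite inE.
rewrite (perm_big _ (uniq_perm (fset_uniq _) uL memL)) /= big_allpairs_dep.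
rewrite big_mkord; apply: eq_bigr => m _; rewrite exprDn big_mkord.
by apply: eq_bigr => j _ /=; rewrite subnK// -ltnS.
Qed.

(** Expand the geometric series of [p + q] by the binomial theorem. The same expansion at
    [normc p + normc q] bounds the absolute sums, and triangles are cofinal among finite sets of
    exponents. *)
Lemma abs_sum_to_geometric2 (p q : R[i]) : normc p + normc q < 1 ->
  abs_sum_to (fun jk : nat * nat => p ^+ jk.1 * q ^+ jk.2 *+ 'C(jk.1 + jk.2, jk.2))
    (1 - p - q)^-1.
Proof.
move=> pq; set x := fun jk : nat * nat => _.
have cov (A : {fset nat * nat}) : exists n0, forall n, (n0 <= n)%N -> (A `<=` triangle n)%fset.
  exists (\max_(a <- A) (a.1 + a.2)).+1 => n hn; apply/fsubsetP => a aA.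
  rewrite in_triangle; apply: leq_ltn_trans hn.
  exact: (@leq_bigmax_seq _ _ xpredT (fun p => p.1 + p.2)%N _ aA).
have pq0 : 0 <= normc p + normc q by rewrite addr_ge0// normc_ge0.
have bnd : abs_bounded x.
  exists (1 - (normc p + normc q))^-1 => A.
  have [n /(_ n (leqnn n)) An] := cov A.
  apply: le_trans (ler_sum_fset _ An) _ => [i|]; first exact: normc_ge0.
  apply: le_trans (@sum_expr_le _ n _); last by rewrite pq0.
  rewrite -sum_triangle; apply: ler_sum => jk _.
  by rewrite /x normcMn normcM !normcX.
split=> //; apply: csum_to_cofinal => // A e e0.
have z1 : p + q != 1.
  apply/eqP => h; have := le_normcD p q; rewrite h normc1; lra.
have z1' : 1 - (p + q) != 0 by rewrite subr_eq0 eq_sym.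
have d0 : 0 < normc (1 - (p + q)).
  by rewrite lt_neqAle normc_ge0 eq_sym andbT; apply: contra_neq z1' => /eq0_normc.
have [n1 An] := cov A.
have pq01 : 0 <= normc p + normc q < 1 by rewrite pq0.
have [n2 hn] := expr_lt_eventually pq01 (mulr_gt0 e0 d0).
exists (triangle (maxn n1 n2)); first by apply: An; rewrite leq_maxl.
rewrite sum_triangle -addrA -opprD expr_sum_inv// normcM normcV normcX.
rewrite ltr_pdivrMr//; apply: le_lt_trans (hn _ (leq_maxr n1 n2)).
by rewrite lerXn2r ?nnegrE ?normc_ge0// le_normcD.
Qed.

(** The local form of [analytic2_on], strengthened to absolute convergence because the Cauchy
    product relies on it. *)
Definition analytic2_at f v0 u0 :=
  exists (a : nat -> nat -> R[i]) (r : R), 0 < r /\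
    forall v u, `|v - v0| < r%:C -> `|u - u0| < r%:C ->
      abs_sum_to (fun jk : nat * nat =>
        a jk.1 jk.2 * (v - v0) ^+ jk.1 * (u - u0) ^+ jk.2) (f v u).

Lemma analytic2_at_ext f g v0 u0 (e : R) : 0 < e ->
  (forall v u, `|v - v0| < e%:C -> `|u - u0| < e%:C -> f v u = g v u) ->
  analytic2_at f v0 u0 -> analytic2_at g v0 u0.
Proof.
move=> e0 fg [a [r [r0 h]]]; exists a, (Num.min r e).
rewrite lt_min r0 e0; split=> // v u; rewrite !normE !ltcR !lt_min.
move=> /andP[v1 v2] /andP[u1 u2]; rewrite -fg ?normE ?ltcR//.
by apply: h; rewrite normE ltcR.
Qed.

Lemma analytic2_at_affine (c x y : R[i]) v0 u0 :
  analytic2_at (fun v u => c + x * v + y * u) v0 u0.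
Proof.
pose a (j k : nat) := if (j, k) == (0, 0)%N then c + x * v0 + y * u0 else
  if (j, k) == (1, 0)%N then x else if (j, k) == (0, 1)%N then y else 0.
exists a, 1; split=> // v u _ _.
pose A := ((0%N, 0%N) |` ((1%N, 0%N) |` [fset (0%N, 1%N)]))%fset.
set F := fun jk : nat * nat => _.
have -> : c + x * v + y * u = \sum_(jk <- A) F jk.
  rewrite /A !big_fsetU1 ?inE //= big_seq_fset1 /F /a /=.
  rewrite !expr0 !expr1; ring.
apply: abs_sum_to_finite => -[j k]; rewrite !inE !negb_or => /and3P[h1 h2 h3].
by rewrite /F /a /= (negbTE h1) (negbTE h2) (negbTE h3) !mul0r.
Qed.

Lemma analytic2_at_cst (c : R[i]) v0 u0 : analytic2_at (fun _ _ => c) v0 u0.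
Proof.
apply: (analytic2_at_ext ltr01 _ (analytic2_at_affine c 0 0 v0 u0)) => v u _ _.
by rewrite !mul0r !addr0.
Qed.

Lemma analytic2_at_add f g v0 u0 : analytic2_at f v0 u0 -> analytic2_at g v0 u0 ->
  analytic2_at (fun v u => f v u + g v u) v0 u0.
Proof.
move=> [a [r [r0 ha]]] [b [t [t0 hb]]]; exists (fun j k => a j k + b j k), (Num.min r t).
rewrite lt_min r0 t0; split=> // v u; rewrite !normE !ltcR !lt_min.
move=> /andP[v1 v2] /andP[u1 u2].
have := abs_sum_to_add (ha v u _ _) (hb v u _ _).
rewrite !normE !ltcR => /(_ v1 u1 v2 u2); congr abs_sum_to.
by apply/funext => jk; ring.
Qed.

Lemma analytic2_at_sum I (r : seq I) (F : I -> R[i] -> R[i] -> R[i]) v0 u0 :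
  (forall i, analytic2_at (F i) v0 u0) ->
  analytic2_at (fun v u => \sum_(i <- r) F i v u) v0 u0.
Proof.
move=> h; elim: r => [|i r ih].
  apply: (analytic2_at_ext ltr01 _ (analytic2_at_cst 0 v0 u0)) => v u _ _.
  by rewrite big_nil.
apply: (analytic2_at_ext ltr01 _ (analytic2_at_add (h i) ih)) => v u _ _.
by rewrite big_cons.
Qed.

(** Cauchy product: multiply the two series as a family over pairs of exponents, then regroup along
    addition of exponents, whose fibres are finite. *)
Lemma analytic2_at_mul f g v0 u0 : analytic2_at f v0 u0 -> analytic2_at g v0 u0 ->
  analytic2_at (fun v u => f v u * g v u) v0 u0.
Proof.
move=> [a [r [r0 ha]]] [b [t [t0 hb]]].
have [box boxE] := fset_segments.
pose fib (jk : nat * nat) : {fset (nat * nat) * (nat * nat)} :=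
  [fset pq in (box jk.1 `*` box jk.2) `*` (box jk.1 `*` box jk.2) |
    (pq.1.1 + pq.2.1, pq.1.2 + pq.2.2)%N == jk]%fset.
have fibE (pq : (nat * nat) * (nat * nat)) jk :
    (pq \in fib jk) = ((pq.1.1 + pq.2.1, pq.1.2 + pq.2.2)%N == jk).
  rewrite /fib !inE andb_idl// => /eqP <- /=.
  by rewrite !boxE; lia.
exists (fun j k => \sum_(pq <- fib (j, k)) a pq.1.1 pq.1.2 * b pq.2.1 pq.2.2), (Num.min r t).
rewrite lt_min r0 t0; split=> // v u; rewrite !normE !ltcR !lt_min.
move=> /andP[v1 v2] /andP[u1 u2].
have := abs_sum_to_fibers fibE (abs_sum_to_mul (ha v u _ _) (hb v u _ _)).
rewrite !normE !ltcR => /(_ v1 u1 v2 u2); congr abs_sum_to.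
apply/funext => -[j k] /=; rewrite -mulrA mulr_suml.
apply: eq_big_seq => pq; rewrite fibE => /eqP[<- <-].
rewrite !exprD; ring.
Qed.

Let mulrMn_reorder (a b c d : R[i]) n : a * c * (b * d) *+ n = a * b *+ n * c * d.
Proof. by rewrite mulrACA mulrA !mulrnAl. Qed.

(** With [w] the value at the centre, the affine function is [w * (1 - p - q)], where [p] and [q]
    are multiples of [v - v0] and [u - u0]; its inverse is a double geometric series. *)
Lemma analytic2_at_inv_affine (c x y : R[i]) v0 u0 : c + x * v0 + y * u0 != 0 ->
  analytic2_at (fun v u => (c + x * v + y * u)^-1) v0 u0.
Proof.
set w := c + _ + _ => w0.
have nw : 0 < normc w.
  by rewrite lt_neqAle normc_ge0 eq_sym andbT; apply: contra_neq w0 => /eq0_normc.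
have d0 : 0 < normc x + normc y + 1 by rewrite ltr_wpDl// addr_ge0// normc_ge0.
(* This radius ensures [normc x * normc (v - v0) + normc y * normc (u - u0) < normc w]; the [+ 1]
   covers [x = y = 0]. *)
have r0 : 0 < normc w / (normc x + normc y + 1) by rewrite divr_gt0.
pose G v u := (1 - (- x / w * (v - v0)) - (- y / w * (u - u0)))^-1.
have aG : analytic2_at G v0 u0.
  exists (fun j k => (- x / w) ^+ j * (- y / w) ^+ k *+ 'C(j + k, k)).
  exists (normc w / (normc x + normc y + 1)); split=> // v u.
  rewrite !normE !ltcR => hv hu.
  pose p := - x / w * (v - v0); pose q := - y / w * (u - u0).
have pq : normc p + normc q < 1.
    rewrite /p /q !normcM !normcN !normcV.
    rewrite -(@ltr_pM2l _ (normc w))// mulr1.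
    set X := normc (v - v0) in hv *; set Y := normc (u - u0) in hu *.
    have -> : normc w * (normc x / normc w * X + normc y / normc w * Y) =
       normc x * X + normc y * Y by field; rewrite gt_eqF.
    move: hv hu; rewrite !ltr_pdivlMr// => hv hu.
    have X0 : 0 <= X := normc_ge0 _; have Y0 : 0 <= Y := normc_ge0 _.
    have [XY|YX] := leP X Y.
      apply: le_lt_trans hu; rewrite mulrDr mulr1 mulrDr [Y * _]mulrC [Y * _]mulrC.
      by rewrite -addrA lerD ?ler_wpM2l ?normc_ge0// lerDl.
    apply: le_lt_trans hv; rewrite mulrDr mulr1 mulrDr [X * _]mulrC [X * _]mulrC.
    by rewrite -addrA lerD// ler_wpDr// ler_wpM2l ?normc_ge0// ltW.
  have := abs_sum_to_geometric2 pq; congr abs_sum_to; apply/funext => -[j k] /=.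
  rewrite /p /q (exprMn j (- x / w)) (exprMn k (- y / w)).
  exact: mulrMn_reorder.
apply: (analytic2_at_ext r0 _ (analytic2_at_mul (analytic2_at_cst w^-1 v0 u0) aG)) => v u _ _.
have E z s : w * (- z / w * s) = - z * s by rewrite mulrA [w * _]mulrC divfK.
by rewrite /G -invfM !mulrBr !E /w; congr (_^-1); ring.
Qed.

Lemma analytic2_at_exprn f v0 u0 n : analytic2_at f v0 u0 ->
  analytic2_at (fun v u => f v u ^+ n) v0 u0.
Proof.
move=> af; elim: n => [|n ih]; first exact: analytic2_at_cst.
apply: (analytic2_at_ext ltr01 _ (analytic2_at_mul af ih)) => v u _ _.
by rewrite exprS.
Qed.

(** Analyticity of the inverse is a hypothesis because inverses are expanded for affine functions
    only. *)
Lemma analytic2_at_exprz f v0 u0 (k : int) : analytic2_at f v0 u0 ->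
  analytic2_at (fun v u => (f v u)^-1) v0 u0 ->
  analytic2_at (fun v u => f v u ^ k) v0 u0.
Proof.
move=> af afV; case: k => n; first exact: analytic2_at_exprn.
apply: (analytic2_at_ext ltr01 _ (analytic2_at_exprn n.+1 afV)) => v u _ _.
by rewrite exprVn.
Qed.
End Analytic.

(** * Integrals over circles *)

Section CircleIntegral.
Variable R : realType.
Implicit Types (g h : R -> R[i]) (t : R).

(** Continuity is taken componentwise, to match [circle_integral], which integrates real and
    imaginary parts separately. *)
Definition ccontinuous g :=
  continuous (fun t => complex.Re (g t)) /\ continuous (fun t => complex.Im (g t)).

Lemma complex_ReD (z w : R[i]) : complex.Re (z + w) = complex.Re z + complex.Re w.
Proof. by case: z w => [a b] [c d]. Qed.

Lemma complex_ImD (z w : R[i]) : complex.Im (z + w) = complex.Im z + complex.Im w.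
Proof. by case: z w => [a b] [c d]. Qed.

Lemma complex_ReM (z w : R[i]) :
  complex.Re (z * w) = complex.Re z * complex.Re w - complex.Im z * complex.Im w.
Proof. by case: z w => [a b] [c d]. Qed.

Lemma complex_ImM (z w : R[i]) :
  complex.Im (z * w) = complex.Re z * complex.Im w + complex.Im z * complex.Re w.
Proof. by case: z w => [a b] [c d]. Qed.

Lemma ccontinuous_cst (c : R[i]) : ccontinuous (fun=> c).
Proof. by split => t; exact: cvg_cst. Qed.

Lemma ccontinuousD g h : ccontinuous g -> ccontinuous h ->
  ccontinuous (fun t => g t + h t).
Proof.
move=> [g1 g2] [h1 h2]; split.
  under [X in continuous X]funext do rewrite complex_ReD.
  by move=> t; apply: cvgD; [exact: g1|exact: h1].
under [X in continuous X]funext do rewrite complex_ImD.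
by move=> t; apply: cvgD; [exact: g2|exact: h2].
Qed.

Lemma ccontinuousM g h : ccontinuous g -> ccontinuous h ->
  ccontinuous (fun t => g t * h t).
Proof.
move=> [g1 g2] [h1 h2]; split.
  under [X in continuous X]funext do rewrite complex_ReM.
  by move=> t; apply: cvgB; apply: cvgM; [exact: g1|exact: h1|exact: g2|exact: h2].
under [X in continuous X]funext do rewrite complex_ImM.
by move=> t; apply: cvgD; apply: cvgM; [exact: g1|exact: h2|exact: g2|exact: h1].
Qed.

Lemma ccontinuousV g : (forall t, g t != 0) -> ccontinuous g ->
  ccontinuous (fun t => (g t)^-1).
Proof.
move=> g0 [g1 g2].
have n0 t : complex.Re (g t) ^+ 2 + complex.Im (g t) ^+ 2 != 0.
  have := g0 t; case: (g t) => a b /=; rewrite eq_complex/= negb_and => ab.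
  by rewrite paddr_eq0 ?sqr_ge0// !sqrf_eq0 negb_and.
have nV : continuous (fun t => (complex.Re (g t) ^+ 2 + complex.Im (g t) ^+ 2)^-1).
  move=> t; apply: cvgV => //; apply: cvgD; rewrite expr2; apply: cvgM => //;
    by [exact: g1|exact: g2].
have VE t : (g t)^-1 =
    (complex.Re (g t) / (complex.Re (g t) ^+ 2 + complex.Im (g t) ^+ 2))
    -i* (complex.Im (g t) / (complex.Re (g t) ^+ 2 + complex.Im (g t) ^+ 2)).
  by case: (g t).
split.
  under [X in continuous X]funext do rewrite VE /=.
  by move=> t; apply: cvgM; [exact: g1|exact: nV].
under [X in continuous X]funext do rewrite VE /=.
by move=> t; apply: cvgN; apply: cvgM; [exact: g2|exact: nV].
Qed.

Lemma ccontinuousX g n : ccontinuous g -> ccontinuous (fun t => g t ^+ n).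
Proof.
move=> cg; elim: n => [|n ih]; first exact: ccontinuous_cst.
under [X in ccontinuous X]funext do rewrite exprS.
exact: ccontinuousM.
Qed.

Lemma ccontinuousXz g (n : int) : (forall t, g t != 0) -> ccontinuous g ->
  ccontinuous (fun t => g t ^ n).
Proof.
move=> g0 cg; case: n => n; first exact: ccontinuousX.
under [X in ccontinuous X]funext do rewrite /exprz.
apply: ccontinuousV; last exact: ccontinuousX.
by move=> t; rewrite expf_neq0.
Qed.

Definition cint g : R[i] :=
  (\int[lebesgue_measure]_(t in `[0, 2 * pi]) complex.Re (g t)) +i*
  (\int[lebesgue_measure]_(t in `[0, 2 * pi]) complex.Im (g t)).

Lemma continuous_integrable_itv (f : R -> R) (a b : R) : continuous f ->
  lebesgue_measure.-integrable `[a, b] (EFin \o f).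
Proof.
move=> cf; apply: continuous_compact_integrable; first exact: segment_compact.
exact: continuous_subspaceT.
Qed.

Lemma cintD g h : ccontinuous g -> ccontinuous h ->
  cint (fun t => g t + h t) = cint g + cint h.
Proof.
move=> [g1 g2] [h1 h2]; rewrite /cint.
under eq_Rintegral do rewrite complex_ReD.
under [X in _ +i* X]eq_Rintegral do rewrite complex_ImD.
by rewrite !RintegralD//; exact: continuous_integrable_itv.
Qed.

Lemma cintZ (c : R[i]) g : ccontinuous g -> cint (fun t => c * g t) = c * cint g.
Proof.
move=> [g1 g2]; rewrite /cint.
under eq_Rintegral do rewrite complex_ReM.
under [X in _ +i* X]eq_Rintegral do rewrite complex_ImM.
have ci f (k : R) : continuous f ->
    lebesgue_measure.-integrable `[0, 2 * pi] (EFin \o (fun t => k * f t)).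
  move=> cf; apply: continuous_integrable_itv => t; apply: cvgM; [exact: cvg_cst|exact: cf].
rewrite RintegralB ?RintegralD//; [|by apply: ci..].
rewrite !RintegralZl//; [|exact: continuous_integrable_itv..].
by case: c => a b.
Qed.

Lemma normc_le_ReIm (z : R[i]) : normc z <= `|complex.Re z| + `|complex.Im z|.
Proof.
case: z => a b /=; have ab0 : 0 <= `|a| + `|b| by rewrite addr_ge0.
rewrite -[leRHS](ger0_norm ab0) -sqrtr_sqr ler_wsqrtr//.
by rewrite sqrrD !real_normK ?num_real// lerD2r lerDl mulrn_wge0// mulr_ge0.
Qed.

Lemma Re_le_normc (z : R[i]) : `|complex.Re z| <= normc z.
Proof. by case: z => a b /=; rewrite -sqrtr_sqr ler_sqrt ?addr_ge0 ?sqr_ge0// lerDl sqr_ge0. Qed.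

Lemma Im_le_normc (z : R[i]) : `|complex.Im z| <= normc z.
Proof. by case: z => a b /=; rewrite -sqrtr_sqr ler_sqrt ?addr_ge0 ?sqr_ge0// lerDr sqr_ge0. Qed.

(** The factor is [4 * pi] and not [2 * pi] because the two components are bounded separately. The
    loss is harmless: the bound only serves to show that a remainder tends to zero. *)
Lemma cint_bound g (M : R) : ccontinuous g -> 
  (forall t, t \in `[0, 2 * pi]%R -> normc (g t) <= M) -> normc (cint g) <= M * (4 * pi).
Proof.
move=> [g1 g2] gM; apply: le_trans (normc_le_ReIm _) _ => /=.
have bnd f : continuous f -> (forall t, t \in `[0, 2 * pi]%R -> `|f t| <= M) ->
    `|\int[lebesgue_measure]_(t in `[0, 2 * pi]) f t| <= M * (2 * pi).
  move=> cf fM; apply: (le_trans (le_normr_Rintegral _ _)) => //.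
    exact: continuous_integrable_itv.
  apply: le_trans (_ : \int[lebesgue_measure]_(t in `[0, 2 * pi]) M <= _).
    apply: le_Rintegral => //; apply: continuous_integrable_itv.
      by move=> t; apply: cvg_norm; exact: cf.
    by move=> t; exact: cvg_cst.
  have mE : lebesgue_measure ([set` `[0, 2 * pi]] : set R) = (2 * pi)%:E.
    by rewrite lebesgue_measure_itv/= lte_fin mulr_gt0 ?pi_gt0//= sube0.
  by rewrite Rintegral_cst// [X in fine X]mE.
have -> : M * (4 * pi) = M * (2 * pi) + M * (2 * pi) by ring.
by apply: lerD; apply: bnd => // t ht; apply: le_trans (gM t ht);
  [exact: Re_le_normc|exact: Im_le_normc].
Qed.

Lemma cexpiD (s t : R) : cexpi (s + t) = cexpi s * cexpi t.
Proof.
rewrite /cexpi cosD sinD; apply/eqP; rewrite eq_complex /=; apply/andP; split; apply/eqP; ring.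
Qed.

Lemma cexpi0 : cexpi (0 : R) = 1.
Proof. by rewrite /cexpi cos0 sin0. Qed.

Lemma normc_cexpi (t : R) : normc (cexpi t) = 1.
Proof. by rewrite /= cos2Dsin2 sqrtr1. Qed.

Lemma cexpi_neq0 (t : R) : cexpi t != 0.
Proof.
apply/eqP => h; have := normc_cexpi t.
by rewrite h normc0 => /eqP; rewrite eq_sym oner_eq0.
Qed.

Lemma cexpi_exprz (t : R) (n : int) : cexpi t ^ n = cexpi (n%:~R * t).
Proof.
have aux m : cexpi t ^+ m = cexpi (m%:R * t).
  elim: m => [|m ih]; first by rewrite mul0r cexpi0.
  by rewrite exprS ih -cexpiD -natr1 mulrDl mul1r addrC.
case: n => n; first exact: aux.
rewrite NegzE mulrNz mulNr -exprnN aux.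
apply: (mulfI (cexpi_neq0 (n.+1%:R * t))).
by rewrite mulfV ?cexpi_neq0// -cexpiD subrr cexpi0.
Qed.

Lemma cexpi2pi : cexpi (2 * pi : R) = 1.
Proof. by rewrite /cexpi mulr_natl cos2pi sin2pi. Qed.

Lemma ccontinuous_cexpi (k : R) : ccontinuous (fun t => cexpi (k * t)).
Proof.
have ck : continuous (fun t : R => k * t).
  by move=> t; apply: cvgM; [exact: cvg_cst|exact: cvg_id].
split=> t /=.
  by apply: continuous_comp; [exact: ck|exact: continuous_cos].
by apply: continuous_comp; [exact: ck|exact: continuous_sin].
Qed.

(** For [n != 0] the components have the antiderivatives [sin (k t) / k] and [- cos (k t) / k],
    which take equal values at both ends because [k] is an integer. *)
Lemma cint_cexpi (n : int) : cint (fun t => cexpi (n%:~R * t)) =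
  if n == 0 then 2 * pi%:C else 0.
Proof.
have pi2 : (0 : R) < 2 * pi by rewrite mulr_gt0 ?pi_gt0.
case: eqVneq => [->|n0].
  under [X in cint X]funext do rewrite mul0r cexpi0.
  have mE : lebesgue_measure ([set` `[0, 2 * pi]] : set R) = (2 * pi)%:E.
    by rewrite lebesgue_measure_itv/= lte_fin pi2 sube0.
  rewrite /cint /= !Rintegral_cst// [X in fine X]mE mul1r mul0r complexr0.
  by rewrite rmorphM/= rmorph_nat.
set k : R := n%:~R; have k0 : k != 0 by rewrite intr_eq0.
have FTC (f F : R -> R) : (forall t : R, is_derive t 1 F (f t)) -> continuous f ->
    \int[lebesgue_measure]_(t in `[0, 2 * pi]) f t = F (2 * pi) - F 0.
  move=> dF cf.
  have cF : continuous F.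
    move=> t; apply/differentiable_continuous/derivable1_diffP.
    by have := dF t; case.
  rewrite /Rintegral (@continuous_FTC2 _ _ F)//.
  - exact: continuous_subspaceT.
  - split=> [t _||].
    + by have := dF t; case.
    + by apply: cvg_at_right_filter; exact: cF.
    + by apply: cvg_at_left_filter; exact: cF.
  - by move=> t _; rewrite derive1E; have := dF t => ?; rewrite derive_val.
have [c1 c2] := ccontinuous_cexpi k.
have e1 : cexpi (k * (2 * pi)) = 1.
  by rewrite /k -cexpi_exprz cexpi2pi exp1rz.
have [cE sE] : cos (k * (2 * pi)) = 1 /\ sin (k * (2 * pi)) = 0 by case: e1.
have dk (t : R) : is_derive t 1 (fun s : R => k * s) k.
  apply: (@is_derive_eq _ _ _ (k \*: id)). exact: mulr1.
have dS (t : R) : is_derive t 1 (fun s => k^-1 * sin (k * s)) (cos (k * t)).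
  apply: (@is_derive_eq _ _ _ (k^-1 \*: (sin \o (fun s : R => k * s)))).
  by rewrite /GRing.scale/=; field.
have dC (t : R) : is_derive t 1 (fun s => k^-1 * - cos (k * s)) (sin (k * t)).
  apply: (@is_derive_eq _ _ _ (k^-1 \*: (- (cos \o (fun s : R => k * s))))).
  by rewrite /GRing.scale/=; field.
rewrite /cint (FTC _ _ dS c1) (FTC _ _ dC c2).
rewrite sE cE !mulr0 sin0 cos0 mulr0 !subrr.
by [].
Qed.

Variable r : R.
Hypothesis r0 : 0 < r.

Definition circ t : R[i] := r%:C * cexpi t.

Lemma normc_circ t : normc (circ t) = r.
Proof. by rewrite /circ normcM normc_cexpi mulr1 normc_real gtr0_norm. Qed.

Lemma circ_neq0 t : circ t != 0.
Proof.
by apply/eqP => h; have := normc_circ t; rewrite h normc0 => e; move: r0; rewrite e ltxx.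
Qed.

Lemma ccontinuous_circ : ccontinuous circ.
Proof.
apply: ccontinuousM; first exact: ccontinuous_cst.
by have := ccontinuous_cexpi 1; under [X in ccontinuous X]funext do rewrite mul1r.
Qed.

Implicit Types f k : R[i] -> R[i].

(** Continuity is required along the circle only, since the integrands have poles elsewhere. *)
Definition ccirc f := ccontinuous (fun t => f (circ t)).

Definition contour f : R[i] := circle_integral f 0 r / (2 * pi%:C * ci R).

Lemma contourE f : ccirc f -> contour f = cint (fun t => f (circ t) * circ t) / (2 * pi%:C).
Proof.
move=> cf; rewrite /contour.
have -> : circle_integral f 0 r = cint (fun t => ci R * (f (circ t) * circ t)).
  rewrite /circle_integral -/(cint _); congr cint; apply/funext => t.
  by rewrite add0r -[ci R * _ * _]mulrA -!/(circ t) mulrCA.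
rewrite cintZ; last by apply: ccontinuousM => //; exact: ccontinuous_circ.
have ci0 : ci R != 0 by rewrite eq_complex /= oner_eq0 andbF.
by rewrite [2 * _ * _]mulrC invfM mulrACA mulfV// mul1r.
Qed.

Lemma eq_contour f k : (forall t, f (circ t) = k (circ t)) -> contour f = contour k.
Proof.
move=> fk; rewrite /contour; congr (_ / _).
rewrite /circle_integral -!/(cint _); congr cint; apply/funext => t.
by rewrite add0r -!/(circ t) fk.
Qed.

Lemma contourD f k : ccirc f -> ccirc k -> contour (fun v => f v + k v) = contour f + contour k.
Proof.
move=> cf ck; rewrite !contourE//; last exact: ccontinuousD.
rewrite -mulrDl; congr (_ / _); rewrite -cintD.
- by congr cint; apply/funext => t; rewrite mulrDl.
- by apply: ccontinuousM => //; exact: ccontinuous_circ.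
- by apply: ccontinuousM => //; exact: ccontinuous_circ.
Qed.

Lemma contourZ (c : R[i]) f : ccirc f -> contour (fun v => c * f v) = c * contour f.
Proof.
move=> cf; rewrite !contourE//; last by apply: ccontinuousM => //; exact: ccontinuous_cst.
rewrite mulrA; congr (_ / _); rewrite -cintZ; last first.
  by apply: ccontinuousM => //; exact: ccontinuous_circ.
by congr cint; apply/funext => t; rewrite mulrA.
Qed.

Lemma contour_bound f (M : R) : ccirc f ->
  (forall t, t \in `[0, 2 * pi]%R -> normc (f (circ t)) <= M) ->
  normc (contour f) <= 2 * r * M.
Proof.
move=> cf fM; rewrite contourE// normcM.
have pi0 : (0 : R) < pi := pi_gt0 R.
have -> : normc (2 * pi%:C)^-1 = (2 * pi)^-1 :> R.
  rewrite normcV -[2]/(2%:R) -(rmorph_nat (real_complex R)) -rmorphM normc_real gtr0_norm//.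
  by rewrite mulr_gt0.
rewrite ler_pdivrMr ?mulr_gt0//.
have -> : 2 * r * M * (2 * pi) = M * r * (4 * pi) by ring.
apply: cint_bound => [|t ht]; first by apply: ccontinuousM => //; exact: ccontinuous_circ.
by rewrite normcM normc_circ ler_wpM2r ?fM// ltW.
Qed.

Lemma ccirc_cst (c : R[i]) : ccirc (fun=> c).
Proof. exact: ccontinuous_cst. Qed.

Lemma ccirc_id : ccirc id.
Proof. exact: ccontinuous_circ. Qed.

Lemma ccircD f k : ccirc f -> ccirc k -> ccirc (fun v => f v + k v).
Proof. exact: ccontinuousD. Qed.

Lemma ccircM f k : ccirc f -> ccirc k -> ccirc (fun v => f v * k v).
Proof. exact: ccontinuousM. Qed.

Lemma ccircXz f (n : int) : (forall t, f (circ t) != 0) -> ccirc f -> ccirc (fun v => f v ^ n).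
Proof. exact: ccontinuousXz. Qed.

(** On the circle [v ^ n * v] is [r ^ (n + 1)] times an exponential of frequency [n + 1], whose
    integral vanishes unless that frequency is zero. *)
Lemma contour_exprz (n : int) : contour (fun v => v ^ n) = (n == -1)%:R.
Proof.
rewrite contourE; last by apply: ccircXz; [exact: circ_neq0|exact: ccirc_id].
have -> : (fun t => circ t ^ n * circ t) = (fun t => r%:C ^ (n + 1) * cexpi ((n + 1)%:~R * t)).
  apply/funext => t; rewrite -[X in _ * X]expr1z -expfzDr ?circ_neq0//.
  by rewrite /circ exprzMl ?unitfE ?cexpi_neq0 ?cexpi_exprz// eq_complex /= eqxx andbT gt_eqF.
rewrite cintZ; last exact: ccontinuous_cexpi.
rewrite cint_cexpi addr_eq0; case: eqP => [->|_]; last by rewrite mulr0 mul0r.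
rewrite addNr expr0z mul1r divff//.
by rewrite mulf_neq0 ?pnatr_eq0// eq_complex /= eqxx andbT gt_eqF// pi_gt0.
Qed.

(** A substitute for holomorphy inside the circle: all integrals against nonnegative powers of [v]
    vanish. The property survives multiplication by [v + 1] and division by [v - c] with [c]
    outside, which takes the place of Cauchy's theorem. *)
Definition residue_free f := ccirc f /\ forall n : nat, contour (fun v => v ^+ n * f v) = 0.

Lemma residue_free1 : residue_free (fun=> 1).
Proof.
split; first exact: ccirc_cst.
by move=> n; rewrite (@eq_contour _ (fun v => v ^ n%:Z)) ?contour_exprz// => t; rewrite mulr1.
Qed.

Lemma ccirc_div f (c : R[i]) : r < normc c -> ccirc f -> ccirc (fun v => f v / (v - c)).
Proof.
move=> rc cf; apply: ccircM => //.
apply: ccontinuousV; last exact: (ccircD ccirc_id (ccirc_cst (- c))).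
by move=> t; rewrite subr_eq0; apply/eqP => h; move: rc; rewrite -h normc_circ ltxx.
Qed.

Lemma ccontinuous_bounded (g : R -> R[i]) (a b : R) : a <= b -> ccontinuous g ->
  exists M, forall t, t \in `[a, b]%R -> normc (g t) <= M.
Proof.
move=> ab [g1 g2]; pose f t := `|complex.Re (g t)| + `|complex.Im (g t)|.
have cf : continuous f.
  by move=> t; apply: cvgD; apply: cvg_norm; [exact: g1|exact: g2].
have [c _ hc] := EVT_max ab (continuous_subspaceT cf).
by exists (f c) => t /hc; exact: le_trans (normc_le_ReIm _).
Qed.

(* Expand [1 / (v - c)] in powers of [v / c]; the remainder is of order
   [(r / |c|)^n]. *)
Lemma residue_free_div f (c : R[i]) : r < normc c -> residue_free f ->
  residue_free (fun v => f v / (v - c)).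
Proof.
move=> rc [cf f0]; have cd := ccirc_div rc cf; split=> // n.
have cX m : ccirc (fun v : R[i] => v ^+ m).
  exact: (@ccircXz id m%:Z circ_neq0 ccirc_id).
have vc t : circ t - c != 0.
  by rewrite subr_eq0; apply/eqP => h; move: rc; rewrite -h normc_circ ltxx.
have nc0 : 0 < normc c by exact: lt_trans rc.
have c0 : c != 0 by apply/eqP => h; move: nc0; rewrite h normc0 ltxx.
(* Write [v^m / (v - c) = c^-1 * v^(m+1) / (v - c) - c^-1 * v^m]; against [f] the last term
   integrates to zero. *)
have step m : contour (fun v => v ^+ m * (f v / (v - c))) =
    c^-1 * contour (fun v => v ^+ m.+1 * (f v / (v - c))).
  have c1 : ccirc (fun v => v ^+ m * f v) by apply: ccircM => //; exact: cX.
  have c2 : ccirc (fun v => v ^+ m.+1 * (f v / (v - c))).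
    by apply: ccircM => //; exact: cX.
  rewrite -[RHS]addr0 -(mulr0 (- c^-1)) -(f0 m) -!contourZ// -contourD; first last.
  - by apply: ccircM => //; exact: ccirc_cst.
  - by apply: ccircM => //; exact: ccirc_cst.
  apply: eq_contour => t; rewrite exprS; move: (vc t) => {}vc.
  by field; rewrite c0 vc.
have stepn m : contour (fun v => v ^+ n * (f v / (v - c))) =
    c^-1 ^+ m * contour (fun v => v ^+ (n + m) * (f v / (v - c))).
  elim: m => [|m ->]; first by rewrite expr0 mul1r addn0.
  by rewrite step addnS exprSr mulrA.
have pi20 : (0 : R) <= 2 * pi by rewrite mulr_ge0// pi_ge0.
have [M hM] := ccontinuous_bounded pi20 cd.
have M0 : 0 <= M.
  by apply: le_trans (normc_ge0 _) (hM 0 _); rewrite in_itv/= lexx.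
set z := contour _; apply: eq0_normc; apply/eqP; rewrite eq_le normc_ge0 andbT.
apply/ler_addgt0Pr => e e0; rewrite add0r.
have rho : 0 <= r / normc c < 1.
  by rewrite divr_ge0 ?ltW// ltr_pdivrMr// mul1r.
(* The [+ 1] keeps the constant positive even if [M = 0], so that [e] may be divided by it when [m]
   is chosen. *)
have K0 : 0 < 2 * r * (r ^+ n * M) + 1 by rewrite ltr_wpDl// !mulr_ge0// ?exprn_ge0// ltW.
have [m /(_ m (leqnn m)) hm] := expr_lt_eventually rho (divr_gt0 e0 K0).
rewrite /z (stepn m) normcM normcX normcV.
have cnm : ccirc (fun v => v ^+ (n + m) * (f v / (v - c))).
  by apply: ccircM => //; exact: cX.
have /(contour_bound cnm) h t : t \in `[0, 2 * pi]%R ->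
    normc (circ t ^+ (n + m) * (f (circ t) / (circ t - c))) <= r ^+ (n + m) * M.
  by move=> ht; rewrite normcM normcX normc_circ ler_wpM2l ?exprn_ge0 ?(ltW r0)// hM.
have cm0 : 0 <= (normc c)^-1 ^+ m by rewrite exprn_ge0// invr_ge0 ltW.
apply: le_trans (ler_wpM2l cm0 h) _.
have -> : (normc c)^-1 ^+ m * (2 * r * (r ^+ (n + m) * M)) =
    (r / normc c) ^+ m * (2 * r * (r ^+ n * M)).
  by rewrite exprMn exprD; ring.
apply: le_trans (_ : e / (2 * r * (r ^+ n * M) + 1) * (2 * r * (r ^+ n * M) + 1) <= _).
  have [rho0 _] := andP rho.
  have K1 : 0 <= 2 * r * (r ^+ n * M) by rewrite !mulr_ge0// ?exprn_ge0// ltW.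
  by apply: ler_pM; rewrite ?exprn_ge0 ?lerDl// ltW.
by rewrite divfK// gt_eqF.
Qed.
End CircleIntegral.

(** * Residues at the origin *)

Section Residues.
Variables (R : realType) (r : R).
Hypotheses (r0 : 0 < r) (r1 : r < 1).

Lemma circD1_neq0 t : circ r t + 1 != 0.
Proof.
rewrite addr_eq0; apply/eqP => h; have := normc_circ r0 t.
by rewrite h normcN normc1 => e; move: r1; rewrite e ltxx.
Qed.

Lemma ccirc_exprz (k : int) : ccirc r (fun v => v ^ k).
Proof. by apply: ccircXz; [exact: circ_neq0|exact: ccirc_id]. Qed.

Lemma ccirc_D1exprz (k : int) : ccirc r (fun v => (v + 1) ^ k).
Proof.
apply: ccircXz; first exact: circD1_neq0.
exact: (ccircD (ccirc_id r) (ccirc_cst r 1)).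
Qed.

Lemma residue_free_mulD1 f : residue_free r f -> residue_free r (fun v => (v + 1) * f v).
Proof.
have cX n : ccirc r (fun v => v ^+ n) by exact: (ccirc_exprz n).
move=> [cf f0]; split.
  by apply: ccircM => //; exact: (ccircD (ccirc_id r) (ccirc_cst r 1)).
move=> n; rewrite (@eq_contour _ _ _ (fun v => v ^+ n.+1 * f v + v ^+ n * f v)).
  by rewrite contourD ?f0 ?addr0//; apply: ccircM.
by move=> t; rewrite exprSr mulrA mulrDr mulr1 mulrDl.
Qed.

Lemma residue_free_eq f g : (forall t, f (circ r t) = g (circ r t)) ->
  residue_free r f -> residue_free r g.
Proof.
move=> fg [cf f0]; split.
  by move: cf; rewrite /ccirc; under [X in ccontinuous X -> _]funext do rewrite fg.
by move=> n; rewrite -(f0 n); apply: eq_contour => t; rewrite fg.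
Qed.

(** Positive powers arise by repeated multiplication by [v + 1], negative ones by repeated division
    by [v - (-1)], whose zero lies outside the circle since [r < 1]. *)
Lemma residue_free_D1exprz (k : int) : residue_free r (fun v => (v + 1) ^ k).
Proof.
case: k => k.
  elim: k => [|k ih]; first exact: residue_free1.
  apply: residue_free_eq (residue_free_mulD1 ih) => t.
  exact/esym/exprS.
have rN1 : r < normc (-1 : R[i]) by rewrite normcN normc1.
elim: k => [|k ih].
  apply: residue_free_eq (residue_free_div r0 rN1 (residue_free1 r0)) => t.
  by rewrite opprK mul1r.
apply: residue_free_eq (residue_free_div r0 rN1 ih) => t.
by rewrite opprK /exprz [in RHS]exprS invfM mulrC.
Qed.

(** The coefficient of [v^(a-1)] in the expansion of [(1 + v)^k] at the origin, that is, a
    generalized binomial coefficient. *)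
Definition res (a k : int) : R[i] := contour r (fun v => v ^ (- a) * (v + 1) ^ k).

Lemma ccirc_res (a k : int) : ccirc r (fun v => v ^ a * (v + 1) ^ k).
Proof. by apply: ccircM; [exact: ccirc_exprz|exact: ccirc_D1exprz]. Qed.

Lemma res_le0 (n : nat) (k : int) : res (- n%:Z) k = 0.
Proof. by rewrite /res opprK; exact: (residue_free_D1exprz k).2. Qed.

Lemma res_pascal (a k : int) : res a (k + 1) = res a k + res (a - 1) k.
Proof.
rewrite -contourD; [|exact: ccirc_res..].
apply: eq_contour => t; rewrite expfzDr ?circD1_neq0// expr1z.
rewrite opprB addrC expfzDr ?circ_neq0// expr1z; ring.
Qed.

Lemma resa0 (a : int) : res a 0 = (a == 1)%:R.
Proof.
rewrite -[a == 1](eqr_opp a 1) -(contour_exprz r0).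
by apply: eq_contour => t; rewrite expr0z mulr1.
Qed.

Lemma res_bin (a k : nat) : res a.+1 k = 'C(k, a)%:R.
Proof.
elim: k a => [|k ih] a; first by rewrite resa0 bin0n; case: a.
rewrite -[k.+1]addn1 PoszD res_pascal ih.
rewrite (_ : a.+1%:Z - 1 = a%:Z); last by lia.
case: a => [|a]; first by rewrite (res_le0 0) addr0 !bin0.
by rewrite ih addn1 binS natrD.
Qed.

(** The reflection formula for binomial coefficients with a possibly negative upper index, obtained
    by running Pascal's rule towards smaller exponents. *)
Lemma res_binN (a D : nat) : res a.+1 (a%:Z - D%:Z - 1) = (-1) ^+ a * 'C(D, a)%:R.
Proof.
elim: D a => [|D ih] a.
  case: a => [|a]; last first.
    by rewrite (_ : _ - _ = a%:Z) ?res_bin ?bin_small ?mulr0 ?bin0n//; lia.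
  (* Base case with exponent [-1]: Pascal's rule expresses [res 1 0] as [res 1 (-1)] plus
     [res 0 (-1)], and the latter has no pole. *)
  have := res_pascal 1 (-1); rewrite (res_le0 0) addr0 => <-.
  by rewrite resa0 bin0 mulr1.
have := res_pascal a.+1 (a%:Z - D.+1%:Z - 1).
rewrite (_ : a%:Z - D.+1%:Z - 1 + 1 = a%:Z - D%:Z - 1); last by lia.
rewrite ih (_ : a.+1%:Z - 1 = a%:Z); last by lia.
case: a => [|a]; first by rewrite (res_le0 0) addr0 !bin0 => <-.
rewrite (_ : a.+1%:Z - D.+1%:Z - 1 = a%:Z - D%:Z - 1); last by lia.
rewrite ih binS natrD exprS => /eqP; rewrite -subr_eq => /eqP <-.
by rewrite mulrDr; congr (_ + _); rewrite mulN1r mulNr.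
Qed.

Variable u : R[i].
Hypothesis ru : r < normc u.

Lemma circB_neq0 t : circ r t - u != 0.
Proof.
rewrite subr_eq0; apply/eqP => h; have := normc_circ r0 t.
by rewrite h => e; move: ru; rewrite e ltxx.
Qed.

(** The residue at the origin in the presence of the kernel [1 / (v - u)]; [u] lies outside the
    circle, so its pole is not enclosed. *)
Definition resu (a k : int) : R[i] :=
  contour r (fun v => v ^ (- a) * (v + 1) ^ k / (v - u)).

Lemma ccirc_resu (a k : int) : ccirc r (fun v => v ^ a * (v + 1) ^ k / (v - u)).
Proof. by apply: ccirc_div => //; exact: ccirc_res. Qed.

Lemma resu0 : resu 0 0 = 0.
Proof.
rewrite -[RHS]((residue_free_div r0 ru (residue_free1 r0)).2 0).
by apply: eq_contour => t; rewrite oppr0 !expr0z expr0 !mul1r.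
Qed.

Lemma u_neq0 : u != 0.
Proof. by apply/eqP => h; move: ru; rewrite h normc0 ltNge ltW. Qed.

(** Split [v + 1 = (v - u) + (u + 1)]; the first summand cancels the kernel. *)
Lemma resu_D1 (a k : int) : resu a (k + 1) = res a k + (u + 1) * resu a k.
Proof.
rewrite -contourZ; last exact: ccirc_resu.
rewrite -contourD; [|exact: ccirc_res|]; last first.
  by apply: ccircM; [exact: ccirc_cst|exact: ccirc_resu].
apply: eq_contour => t; rewrite expfzDr ?circD1_neq0// expr1z.
by have := circB_neq0 t => *; field.
Qed.

(** Partial fractions: [v^(-b-1) / (v - u) = u^-1 * (v^(-b) / (v - u) - v^(-b-1))], and among pure
    powers only [v^-1] has a residue. *)
Lemma resu_a0 (a : nat) : resu a.+1 0 = - u ^ (- a.+1%:Z).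
Proof.
have step (b : nat) : resu b.+1 0 = u^-1 * (resu b 0 - res b.+1 0).
  have c1 := ccirc_resu (- b%:Z) 0; have c2 := ccirc_res (- b.+1%:Z) 0.
  have c3 : ccirc r (fun v => -1 * (v ^ (- b.+1%:Z) * (v + 1) ^ 0)).
    by apply: ccircM => //; exact: ccirc_cst.
  rewrite -mulN1r -contourZ// -contourD// -contourZ; last exact: ccircD.
  apply: eq_contour => t; rewrite expr0z !mulr1.
  rewrite (_ : - b%:Z = - b.+1%:Z + 1) ?expfzDr ?circ_neq0 ?expr1z//; last by lia.
  have := circB_neq0 t; have := u_neq0 => *; field.
  by apply/andP.
elim: a => [|a ih].
  by rewrite step resu0 resa0 sub0r mulrN mulr1 exprN1.
rewrite step ih resa0 /= subr0 mulrN; congr (- _).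
by rewrite -exprN1 -expfzDr ?u_neq0//; congr (_ ^ _); lia.
Qed.

(** As long as the exponent stays at most [a], the [res] terms of [resu_D1] are zero binomials, so
    each factor [v + 1] turns into [u + 1]. *)
Lemma resu_bin (a j : nat) : (j <= a)%N ->
  resu a.+1 j = - (u ^ (- a.+1%:Z) * (u + 1) ^+ j).
Proof.
elim: j => [|j ih] ja; first by rewrite resu_a0 expr0 mulr1.
rewrite -[j.+1]addn1 PoszD resu_D1 res_bin bin_small// add0r ih ?(ltnW ja)//.
by rewrite addn1 exprS mulrN mulrCA.
Qed.

(** Start from [resu_bin] at exponent [a] and apply [resu_D1] downwards; each step releases one
    residue given by [res_binN]. These residues later cancel the contribution of the starting points
    up to [y_1]. *)
Lemma resu_telescope (a n : nat) (y : int) : u + 1 != 0 ->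
  (u + 1) ^ (y + 1 + n%:Z) * resu a.+1 (a%:Z - n%:Z) =
  - (u ^ (- a.+1%:Z) * (u + 1) ^ (y + a.+1%:Z)) -
  \sum_(j < n) (u + 1) ^ (y + 1 + j%:Z) * ((-1) ^+ a * 'C(j, a)%:R).
Proof.
move=> u1; elim: n => [|n ih].
  rewrite big_ord0 !subr0 resu_bin// mulrN mulrCA (exprnP _ a) -expfzDr//.
  by rewrite -addrA -PoszD add1n.
rewrite big_ord_recr/= opprD addrA -ih -res_binN.
rewrite (_ : a%:Z - n%:Z = a%:Z - n.+1%:Z + 1); last by lia.
rewrite resu_D1 (_ : y + 1 + n.+1%:Z = y + 1 + n%:Z + 1) ?expfzDr// ?expr1z; last by lia.
rewrite (_ : a%:Z - n.+1%:Z + 1 - 1 = a%:Z - n.+1%:Z); last by lia.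
have E (X A B w : R[i]) : X * w * B = X * (A + w * B) - X * A by ring.
exact: E.
Qed.
End Residues.

(** * Countably valued random variables *)

Section CountableValued.
Context {d : measure_display} {T : measurableType d} {R : realType}.

Section Map.
Variables (C : countType) (h : T -> C).
Hypothesis mh : forall c, measurable (h @^-1` [set c]).

(** Cuts the preimage of [A] into disjoint level sets indexed by the codes of the values, so that
    countable additivity applies. *)
Let piece (A : set C) n : set T :=
  if @pickle_inv C n is Some c then if `[< A c >] then h @^-1` [set c] else set0 else set0.

Let piece_bigcup A : h @^-1` A = \bigcup_n piece A n.
Proof.
apply/seteqP; split=> [w Aw|w [n _]].
  by exists (choice.pickle (h w)) => //; rewrite /piece pickleK_inv; case: asboolP.
by rewrite /piece; case: pickle_inv => // c; case: asboolP => // Ac /= wc; rewrite /preimage/= wc.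
Qed.

Let measurable_piece A n : measurable (piece A n).
Proof. by rewrite /piece; case: pickle_inv => [c|] //; case: ifP. Qed.

Let trivIset_piece A : trivIset setT (piece A).
Proof.
have pieceP n w : piece A n w -> n = choice.pickle (h w).
  rewrite /piece; have := @pickle_invK C n.
  by case: pickle_inv => //= c <-; case: ifP => // _ /= ->.
apply/trivIsetP => i j _ _; apply: contra_neqP => /eqP/set0P[w [iw jw]].
by rewrite (pieceP i w)// -(pieceP j w).
Qed.

Lemma measurable_preimage_countable (A : set C) : measurable (h @^-1` A).
Proof. by rewrite piece_bigcup; apply: bigcupT_measurable. Qed.

Lemma measurable_fun_countable (f : C -> R) : measurable_fun setT (f \o h).
Proof.
move=> _ B mB; rewrite setTI comp_preimage; exact: measurable_preimage_countable.
Qed.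

(** Countable additivity carries proportionality from single values of [h] to any set of values. It
    extends the transition rule from one history to a set of histories. *)
Lemma measure_eq_scale_countable (P : {measure set T -> \bar R}) (A : set C) (E : set T) (c : R) :
  measurable E ->
  (forall a, A a -> P (h @^-1` [set a] `&` E) = c%:E * P (h @^-1` [set a]))%E ->
  (P (h @^-1` A `&` E) = c%:E * P (h @^-1` A))%E.
Proof.
move=> mE hc.
rewrite piece_bigcup setI_bigcupl measure_bigcup//; last 2 first.
- by move=> i _; apply: measurableI.
- by apply: trivIset_setIr.
rewrite measure_bigcup// -nneseriesZl//; apply: eq_eseriesr => n _.
rewrite /piece; case: pickle_inv => [a|]; last by rewrite set0I measure0 mule0.
by case: asboolP => [/hc//|_]; rewrite set0I measure0 mule0.
Qed.
End Map.

(** Measurability of [X] is assumed, since almost sure equality with a simple function does not give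
    it in general. *)
Lemma expectation_ae_simple (P : probability T R) (I : Type) (s : seq I) (c : I -> R)
    (A : I -> set T) (X : T -> R) :
  measurable_fun setT X -> (forall i, measurable (A i)) ->
  (\forall w \ae P, X w = \sum_(i <- s) c i * \1_(A i) w) ->
  P.-integrable setT (EFin \o X) /\
  fine 'E_P[X] = \sum_(i <- s) c i * fine (P (A i)).
Proof.
move=> mX mA ae.
pose S w := (\sum_(i <- s) (c i)%:E * (\1_(A i) w)%:E)%E.
have i1 i : P.-integrable setT (fun w => (c i)%:E * (\1_(A i) w)%:E)%E.
  by apply: integrableZl => //; exact: integrable_indic.
have iS : P.-integrable setT S by exact: integrable_sum.
have XS : ae_eq P setT (EFin \o X) S.
  apply: filterS ae => w /= -> _; rewrite /S -sumEFin.
  by apply: eq_bigr => i _; rewrite EFinM.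
have /measurable_EFinP mX' := mX.
have mS := measurable_int _ iS.
split.
  move/integrableP : iS => [_ fin]; apply/integrableP; split=> //.
  rewrite (ae_eq_integral _ _ _ _ _ (ae_eq_abse XS))//; exact: measurableT_comp.
rewrite unlock (ae_eq_integral _ _ _ _ _ XS)// integral_sum//.
have E i : (\int[P]_w ((c i)%:E * (\1_(A i) w)%:E) = (c i * fine (P (A i)))%:E)%E.
  rewrite integralZl//; last exact: integrable_indic.
  by rewrite integral_indic// setIT EFinM fineK// fin_num_measure.
by under eq_bigr do rewrite E; rewrite sumEFin.
Qed.
End CountableValued.

(** * The stopped geometric walk *)

Lemma hitting_timeP N (Y : 'I_N -> int) (g : nat -> int) :
  (exists m : 'I_N, [/\ hitting_time Y g = m, Y m < g m &
     forall j : 'I_N, (j < m)%N -> g j <= Y j]) \/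
  (hitting_time Y g = N /\ forall j : 'I_N, g j <= Y j).
Proof.
have le (r : seq 'I_N) (i : 'I_N) : i \in r -> Y i < g i ->
    (\big[minn/N]_(j <- r | (Y j < g j)%R) j <= i)%N.
  elim: r => // j r ih; rewrite inE big_cons => /orP[/eqP <- ->|ir Pi].
    by rewrite geq_minl.
  case: ifP => _; last exact: ih.
  by rewrite geq_min ih ?orbT.
case: (pickP (fun m : 'I_N => Y m < g m)) => [m0 Pm0|none].
  left; case: (@arg_minnP _ m0 (fun m => Y m < g m) (fun m : 'I_N => m : nat) Pm0) => m Pm mmin.
  exists m; split => //.
    apply/eqP; rewrite eqn_leq le ?mem_index_enum//=.
    rewrite /hitting_time; elim/big_ind: _ => //; first exact: ltnW.
    by move=> a b ma mb; rewrite leq_min ma.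
  move=> j jm; rewrite leNgt; apply/negP => /mmin; lia.
right; split; last by move=> j; rewrite leNgt none.
by rewrite /hitting_time big_pred0.
Qed.

Section Walk.
Context {R : realType} {d : measure_display} {T : measurableType d}.
Variables (P : probability T R) (G : nat -> T -> int) (z : int).
Hypothesis hG : geometric_walk P G z.

(** A finite history takes values in a countable type, so every event it determines is
    measurable. *)
Definition hist k (w : T) : k.+1.-tuple int := [tuple G j w | j < k.+1].

Lemma nth_hist k w j : (j <= k)%N -> nth 0 (hist k w) j = G j w.
Proof.
move=> jk.
by rewrite -(@nth_mktuple _ _ (fun i => G i w) 0 (Ordinal (jk : j < k.+1)%N)).
Qed.

Lemma hist_preimage1 k (p : k.+1.-tuple int) :
  hist k @^-1` [set p] = [set w | forall j, (j <= k)%N -> G j w = nth 0 p j].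
Proof.
apply/seteqP; split=> [w /= <- j jk|w /= h]; first by rewrite nth_hist.
by apply: eq_from_tnth => i; rewrite tnth_mktuple (tnth_nth 0) h// -ltnS.
Qed.

Lemma measurable_hist1 k (p : k.+1.-tuple int) : measurable (hist k @^-1` [set p]).
Proof.
case: hG => mG _ _; rewrite hist_preimage1.
rewrite (_ : mkset _ = \bigcap_(j in `I_k.+1) [set w | G j w = nth 0 p j])//.
by apply: bigcap_measurable => //; exists 0%N.
Qed.

Lemma measurable_hist k (A : set (k.+1.-tuple int)) : measurable (hist k @^-1` A).
Proof. exact/measurable_preimage_countable/measurable_hist1. Qed.

Lemma walk_markov k (A : set (k.+1.-tuple int)) y x :
  (forall p, A p -> nth 0 p k = y) ->
  (P (hist k @^-1` A `&` [set w | G k.+1 w = x]) =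
   (geom_step R y x)%:E * P (hist k @^-1` A))%E.
Proof.
move=> Ay; case: hG => mG _ mk; apply: measure_eq_scale_countable => //.
  exact: measurable_hist1.
(* The history [p] prolonged by [x] to a total path, as [geometric_walk] quantifies over paths
   indexed by all times. *)
move=> p /Ay <-; pose f j := if (j <= k)%N then nth 0 p j else x.
have fk : f k = nth 0 p k by rewrite /f leqnn.
have fk1 : f k.+1 = x by rewrite /f ltnn.
have := mk k f; rewrite fk fk1 muleC.
congr (_ = _ * _)%E; congr (P _).
  rewrite hist_preimage1; apply/seteqP; split=> [w h|w [h hx] j] /=.
    split=> [j jk|]; first by rewrite h ?(leq_trans jk)// /f jk.
    by rewrite h// /f ltnn.
  rewrite leq_eqVlt => /orP[/eqP ->|jk]; first by rewrite fk1.
  by rewrite /f -ltnS jk h.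
rewrite hist_preimage1; apply/seteqP; split=> w /= h j jk.
  by rewrite h// /f jk.
by rewrite h// /f jk.
Qed.

Let walk0C : P (~` [set w | G 0%N w = z]) = 0%E.
Proof. by case: hG => mG P0 _; rewrite probability_setC// [X in (1 - X)%E]P0 subee. Qed.

Lemma ae_walk : \forall w \ae P, G 0%N w = z /\ forall k, G k.+1 w < G k w.
Proof.
case: (hG) => mG P0 mk.
have a0 : \forall w \ae P, G 0%N w = z.
  exists (~` [set w | G 0%N w = z]); split=> //; exact: measurableC.
suff : \forall w \ae P, forall k, G k.+1 w < G k w.
  by apply: filterS2 a0 => w.
(* The histories that fail to descend at step [k]: each is null because its [geom_step] is zero, and
   the countable union of them is null with [c = 0] in the scaling lemma. *)
apply: ae_foralln => k; pose A := [set p : k.+2.-tuple int | nth 0 p k <= nth 0 p k.+1].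
exists (hist k.+1 @^-1` A); split; first exact: measurable_hist.
- have := @measure_eq_scale_countable _ _ _ _ _ (@measurable_hist1 k.+1) P A setT 0 measurableT.
  rewrite setIT mul0e; apply => p Ap; rewrite setIT mul0e hist_preimage1.
  by have := mk k (nth 0 p); rewrite /geom_step ltNge [_ <= _]Ap /= mule0.
- move=> w /=; rewrite /A /preimage /= !nth_hist//.
  by move=> /negP; rewrite -leNgt.
Qed.

Lemma walk_le k : \forall w \ae P, G k w <= z.
Proof.
apply: filterS ae_walk => w [<- dec].
by elim: k => // k ih; apply: le_trans ih; exact: ltW.
Qed.

Section Epigraph.
Variables (N : nat) (Y : 'I_N -> int).

(** The event that the walk is at [x] at time [m] and has not hit before [m]; it is a hit at [m]
    exactly when moreover [x > y_{m+1}]. *)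
Definition first_visit m x :=
  [set w | (forall j : 'I_N, (j < m)%N -> G j w <= Y j) /\ G m w = x].

Let first_visitE m x : first_visit m x = hist m @^-1`
  [set p | (forall j : 'I_N, (j < m)%N -> nth 0 p j <= Y j) /\ nth 0 p m = x].
Proof.
apply/seteqP; split=> w; rewrite /first_visit /preimage /= nth_hist// => -[h ->];
  split=> // j jm.
  by rewrite nth_hist ?h// ltnW.
by rewrite -(@nth_hist m) ?h// ltnW.
Qed.

Lemma measurable_first_visit m x : measurable (first_visit m x).
Proof. rewrite first_visitE; exact: measurable_hist. Qed.

Definition visit_prob m x : R := fine (P (first_visit m x)).

Lemma visit_prob0 x : visit_prob 0 x = (x == z)%:R.
Proof.
case: (hG) => mG P0 _; rewrite /visit_prob.
have -> : first_visit 0 x = [set w | G 0%N w = x].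
  by apply/seteqP; split=> w; [case|move=> ?; split].
case: eqVneq => [->|xz]; first by rewrite [X in fine X]P0.
have -> // : P [set w | G 0%N w = x] = 0%E.
apply: (@subset_measure0 _ _ _ P _ (~` [set w | G 0%N w = z])) => //.
- exact: measurableC.
- by move=> w /= -> /eqP; apply/negP.
Qed.

Variables (L : int) (n : nat).
(** The window [L+1, ..., L+n]. It omits [L] itself because [L] bounds all the [y_m] from below in
    the uses, so hits occur strictly above it. *)
Definition level (j : 'I_n) : int := L + j.+1%:Z.

Lemma level_inj : injective level.
Proof. by move=> i j; rewrite /level => h; apply: val_inj => /=; lia. Qed.

Hypothesis zL : z <= L + n%:Z.

Lemma level_exists x : L < x <= z -> exists j, level j = x.
Proof.
move=> /andP[Lx xz].
have jn : (absz (x - L - 1)%R < n)%N by lia.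
exists (Ordinal jn); rewrite /level /=; lia.
Qed.

(** The forward equation of the walk killed on hitting. The previous site lies between [x] and [z]
    because the walk descends, so the finite window covers it. *)
Lemma visit_prob_rec (m : 'I_N) x : L < x ->
  visit_prob m.+1 x =
  \sum_j (level j <= Y m)%R%:R * (geom_step R (level j) x * visit_prob m (level j)).
Proof.
move=> Lx; case: (hG) => mG _ _.
have mE : measurable_fun setT (\1_(first_visit m.+1 x) : T -> R).
  exact/measurable_indicP/measurable_first_visit.
(* The expectation of one indicator is computed twice, first as it stands and then split according
   to the previous site. *)
have ae1 : \forall w \ae P, \1_(first_visit m.+1 x) w =
    \sum_(i <- [:: tt]) (1 : R) * \1_(first_visit m.+1 x) w.
  by apply: aeW => w; rewrite big_seq1 mul1r.
have [_ e1] := expectation_ae_simple mE (fun=> measurable_first_visit m.+1 x) ae1.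
pose A j := first_visit m (level j) `&` [set w | G m.+1 w = x].
have mA j : measurable (A j) by apply: measurableI => //; exact: measurable_first_visit.
have ae2 : \forall w \ae P, \1_(first_visit m.+1 x) w =
    \sum_j (level j <= Y m)%R%:R * \1_(A j) w :> R.
  have := walk_le m; have := ae_walk; apply: filterS2 => w [_ dec] Gz.
  have [hGx|h] := pselect (first_visit m.+1 x w).
    rewrite [LHS]indicE mem_set//; case: hGx => h Gx.
    have [j hj] : exists j, level j = G m w.
      by apply: level_exists; rewrite Gz andbT (lt_trans Lx)// -Gx.
    rewrite (bigD1 j)//= hj h// mul1r indicE mem_set; last first.
      by split=> //; split=> // i im; apply: h; exact: ltnW.
    rewrite big1 ?addr0// => i ij; rewrite indicE memNset ?mulr0//.
    by move=> [[_ /eqP]]; rewrite -hj (inj_eq level_inj) eq_sym (negbTE ij).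
  rewrite [LHS]indicE memNset//.
  rewrite big1// => j _; have [jY|] := boolP (level j <= Y m); last by rewrite mul0r.
  rewrite indicE memNset ?mulr0// => -[[hj Gj] Gx]; apply: h; split=> // i.
  rewrite ltnS leq_eqVlt => /orP[/eqP/val_inj ->|]; [by rewrite Gj|exact: hj].
have [_ e2] := expectation_ae_simple mE mA ae2.
move: e1; rewrite big_seq1 mul1r -/(visit_prob _ _) => <-; rewrite e2.
apply: eq_bigr => j _; congr (_ * _).
rewrite /A first_visitE (@walk_markov _ _ (level j)); last by move=> p [].
rewrite -first_visitE fineM// fin_num_measure//; exact: measurable_first_visit.
Qed.

Variable (v : R[i]).

Definition payoff_at (m : nat) (x : int) : R[i] :=
  2 / (2 * v + 2) ^ (x + 1) * (- v / (v + 1)) ^+ m.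

Hypothesis LY : forall m, L <= Y m.

(** Almost surely the hit value lies in the window, and at most one pair [(m, x)] is the pair of
    hitting time and hitting place, so the payoff is a finite simple function. *)
Lemma ch_payoff_ae : \forall w \ae P, ch_payoff Y G v w =
  \sum_(p : 'I_N * 'I_n) payoff_at p.1 (level p.2) * (Y p.1 < level p.2)%R%:R *
    (\1_(first_visit p.1 (level p.2)) w : R)%:C.
Proof.
have : \forall w \ae P, forall k, G k w <= z by apply: ae_foralln => k; exact: walk_le.
apply: filterS => w Gz.
rewrite /ch_payoff; case: (hitting_timeP Y (fun k => G k w)) => [[m [-> Ym before]]|[-> none]].
  rewrite ltn_ord mulr1 -/(payoff_at m (G m w)).
  have [j hj] : exists j, level j = G m w.
    by apply: level_exists; rewrite Gz andbT (le_lt_trans (LY m)).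
  rewrite (bigD1 (m, j))//= hj Ym mulr1 indicE mem_set ?mulr1//.
  rewrite big1 ?addr0// => -[m' j'] /= ne; have [Yj|] := boolP (Y m' < level j'); last first.
    by rewrite mulr0 mul0r.
  rewrite indicE memNset ?mulr0// => -[h Gj].
  have mm : m' = m.
    apply: val_inj; case: (ltngtP m' m) => // lt.
      by have := before _ lt; rewrite Gj leNgt Yj.
    by have := h _ lt; rewrite leNgt Ym.
  by move/eqP: ne; apply; congr (_, _) => //; apply: level_inj; rewrite hj -Gj mm.
rewrite ltnn mulr0 big1// => -[m j] _ /=.
have [Yj|] := boolP (Y m < level j); last by rewrite mulr0 mul0r.
rewrite indicE memNset ?mulr0// => -[_ Gj].
by have := none m; rewrite Gj leNgt Yj.
Qed.

(** The payoff as a function of a bare path, so that it factors through a history. That history runs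
    up to time [N], the default value of the hitting time. *)
Definition path_payoff (g : nat -> int) : R[i] :=
  let tau := hitting_time Y g in
  2 / (2 * v + 2) ^ (g tau + 1) * (- v / (v + 1)) ^+ tau * (tau < N)%:R.

Lemma ch_payoff_hist w : ch_payoff Y G v w = path_payoff (fun j => nth 0 (hist N w) j).
Proof.
rewrite /ch_payoff /path_payoff; set t := hitting_time _ _; set t' := hitting_time _ _.
have <- : t = t' by apply: eq_bigl => i; rewrite nth_hist//; exact: ltnW.
rewrite nth_hist// /t.
by case: (hitting_timeP Y (fun k => G k w)) => [[m [-> _ _]]|[-> _]] //; exact: ltnW.
Qed.

Lemma measurable_ch_payoff (h : R[i] -> R) :
  measurable_fun setT (fun w => h (ch_payoff Y G v w)).
Proof.
have := measurable_fun_countable (@measurable_hist1 N)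
  (fun p : N.+1.-tuple int => h (path_payoff (fun j => nth 0 p j))).
by congr measurable_fun; apply/funext => w /=; rewrite ch_payoff_hist.
Qed.

Lemma ch_payoff_expectation :
  cintegrable P (ch_payoff Y G v) /\
  cexpectation P (ch_payoff Y G v) =
  \sum_(m < N) \sum_(j < n) payoff_at m (level j) * (Y m < level j)%R%:R *
    (visit_prob m (level j))%:C.
Proof.
(* Real and imaginary parts are treated at once as additive maps [h] compatible with real
   scalars. *)
have part (h : R[i] -> R) : h 0 = 0 -> {morph h : x y / x + y} ->
    (forall x (y : R), h (x * y%:C) = h x * y) ->
    P.-integrable setT (fun w => (h (ch_payoff Y G v w))%:E) /\
    fine 'E_P[fun w => h (ch_payoff Y G v w)] =
    h (\sum_(m < N) \sum_(j < n) payoff_at m (level j) * (Y m < level j)%R%:R *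
      (visit_prob m (level j))%:C).
  move=> h0 hD hM.
  pose c (p : 'I_N * 'I_n) := h (payoff_at p.1 (level p.2) * (Y p.1 < level p.2)%R%:R).
  have aeh : \forall w \ae P, h (ch_payoff Y G v w) =
      \sum_p c p * \1_(first_visit p.1 (level p.2)) w.
    apply: filterS ch_payoff_ae => w ->; rewrite (big_morph h hD h0).
    by apply: eq_bigr => p _; rewrite hM.
  have [] := expectation_ae_simple (measurable_ch_payoff h)
    (fun p : 'I_N * 'I_n => measurable_first_visit p.1 (level p.2)) aeh.
  move=> hi ->; split=> //.
  rewrite pair_bigA (big_morph h hD h0); apply: eq_bigr => p _.
  by rewrite hM.
have [iR eR] := part (@complex.Re R) erefl (@complex_ReD R)
  (fun x y => ltac:(by rewrite complex_ReM /= mulr0 subr0)).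
have [iI eI] := part (@complex.Im R) erefl (@complex_ImD R)
  (fun x y => ltac:(by rewrite complex_ImM /= mulr0 add0r)).
split; first by split.
by rewrite /cexpectation eR eI; case: (\sum_(m < N) _).
Qed.
End Epigraph.
End Walk.

(** * The backward equation *)

(** The hockey-stick identity with the range encoded by a condition. For [j < e] truncated
    subtraction makes both sides zero. *)
Lemma sum_bin_shift (n j e b : nat) : (j <= n)%N ->
  (\sum_(i < n) (if (e <= i < j) then 'C(i - e, b) else 0) = 'C(j - e, b.+1))%N.
Proof.
move=> jn.
rewrite (eq_bigr (fun i : 'I_n =>
    if (i < j)%N then if (e <= i)%N then 'C(i - e, b) else 0%N else 0%N)); last by move=> i _; case: (e <= i)%N; rewrite ?if_same.
rewrite -big_mkcond /= -(big_ord_widen _ (fun i => if (e <= i)%N then 'C(i - e, b) else 0%N))//.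
elim: j {jn} => [|j ih]; first by rewrite big_ord0 sub0n bin0n.
rewrite big_ord_recr /= ih; case: ltngtP => ej.
- by rewrite subSn ?(ltnW ej)// binS.
- have [-> ->] : (j - e = 0)%N /\ (j.+1 - e = 0)%N by lia.
  by rewrite bin0n.
- by rewrite ej subnn subSnn binS.
Qed.

Section Martingale.
Context {R : realType} {d : measure_display} {T : measurableType d}.
Variables (P : probability T R) (G : nat -> T -> int) (z : int).
Hypothesis hG : geometric_walk P G z.
Variables (N : nat) (Y : 'I_N -> int) (L : int) (n : nat) (a : 'I_N).
Hypotheses (zL : z <= L + n%:Z) (LY : forall m, L <= Y m).

Local Notation lev := (@level L n).
Local Notation q := (visit_prob P G Y).

(* Up to the sign [(-1)^a], the residue of the payoff at [(m, x)] when [x > y_{a+1}]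
   (see [contour_payoff_heat]), cut off outside the epigraph. *)
Definition heat (m : nat) (x : int) : R :=
  if Y a < x then (2 ^ x)^-1 * 'C(absz (x - Y a - 1)%R, a - m)%:R else 0.

(** The backward equation. The powers of 2 from the step and from [heat] combine to [2 ^ (- lev j)],
    and the remaining binomial sum is the hockey-stick identity; sites at or below [L] carry no
    [heat]. *)
Lemma heat_step m (j : 'I_n) : (m < a)%N ->
  heat m (lev j) = \sum_i geom_step R (lev j) (lev i) * heat m.+1 (lev i).
Proof.
(* The offset of [y_{a+1}] in the window: [lev k] exceeds [Y a] exactly when [e <= k]. *)
move=> ma; pose e := absz (Y a - L)%R.
have Ye : Y a = L + e%:Z by have := LY a; rewrite /e; lia.
have levY k : (Y a < lev k) = (e <= k)%N by rewrite /level Ye; lia.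
have levE (k : 'I_n) : (e <= k)%N -> absz (lev k - Y a - 1)%R = (k - e)%N by rewrite /level Ye; lia.
have two0 : (2 : R) != 0 by rewrite pnatr_eq0.
transitivity ((2 ^ lev j)^-1 *
    (\sum_(i < n) (if (e <= i < j)%N then 'C(i - e, a - m.+1) else 0))%N%:R : R).
  rewrite sum_bin_shift; last exact: ltnW.
  rewrite -subSn// subSS /heat levY; case: leqP => [ej|je]; first by rewrite levE.
  have -> : (j - e = 0)%N by lia.
  by rewrite bin0n (_ : (a - m == 0)%N = false) ?mulr0//; lia.
rewrite natr_sum mulr_sumr; apply: eq_bigr => i _.
have -> : geom_step R (lev j) (lev i) = if (i < j)%N then (2 ^ (lev j - lev i))^-1 else 0.
  by rewrite /geom_step (_ : (lev i < lev j) = (i < j)%N)// /level; lia.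
rewrite /heat levY; case: (leqP e i) => [ei|ie] /=; last by rewrite mulr0n !mulr0.
rewrite levE//; case: ifP => _; last by rewrite mul0r mulr0.
rewrite mulrA -invfM -expfzDr// subrK//.
Qed.

(** [Y] made total on [nat], so that sums over [m < k] can grow by induction; the value [0] is a
    dummy beyond [N]. *)
Let Yn (k : nat) : int := if insub k is Some m then Y m else 0.

Let YnE (m : 'I_N) : Yn m = Y m.
Proof. by rewrite /Yn valK. Qed.

(** Optional stopping at time [k]: mass that has hit is set aside, and the rest moves one step by
    the forward equation, which conserves its [heat] by the backward equation. *)
Lemma heat_unfold k : (k <= a)%N ->
  \sum_j q 0 (lev j) * heat 0 (lev j) =
  \sum_(m < k) \sum_j (Yn m < lev j)%R%:R * (q m (lev j) * heat m (lev j)) +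
  \sum_j q k (lev j) * heat k (lev j).
Proof.
elim: k => [|k ih] ka; first by rewrite big_ord0 add0r.
rewrite (ih (ltnW ka)) big_ord_recr /= -addrA; congr (_ + _).
pose m := Ordinal (ltn_trans ka (ltn_ord a)).
have -> : \sum_j q k.+1 (lev j) * heat k.+1 (lev j) =
    \sum_j (lev j <= Yn k)%R%:R * (q k (lev j) * heat k (lev j)).
  have rec j : q k.+1 (lev j) = \sum_i (lev i <= Yn k)%R%:R *
      (geom_step R (lev i) (lev j) * q k (lev i)).
    by rewrite (YnE m) -(@visit_prob_rec _ _ _ _ _ _ hG _ _ _ _ zL m)// /level ltrDl.
  under eq_bigr do rewrite rec mulr_suml.
  rewrite exchange_big; apply: eq_bigr => i _; rewrite heat_step// !mulr_sumr.
  by apply: eq_bigr => j _; ring.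
rewrite -big_split; apply: eq_bigr => j _ /=; rewrite -mulrDl ltNge.
by case: (_ <= _); rewrite /= ?add0r ?addr0 mul1r.
Qed.

(** Take [k = a] above. At that time [heat] vanishes off the epigraph, so the surviving mass
    contributes through hits only; at time 0 the mass sits at [z]. *)
Lemma heat_sum :
  \sum_(m < N) \sum_j ((m <= a)%N && (Y m < lev j))%:R * (q m (lev j) * heat m (lev j)) =
  heat 0 z.
Proof.
transitivity (\sum_j q 0 (lev j) * heat 0 (lev j)).
  rewrite (heat_unfold (leqnn a)).
  transitivity (\sum_(m < a.+1) \sum_j (Yn m < lev j)%R%:R * (q m (lev j) * heat m (lev j))).
    rewrite (big_ord_widen N (fun m =>
      \sum_j (Yn m < lev j)%R%:R * (q m (lev j) * heat m (lev j))))//.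
    rewrite [RHS]big_mkcond; apply: eq_bigr => m _; rewrite ltnS YnE.
    by case: leqP => //= _; rewrite big1// => j _; rewrite mul0r.
  rewrite big_ord_recr /=; congr (_ + _); apply: eq_bigr => j _.
  by rewrite YnE /heat; case: ifP => _; rewrite ?mul1r// !mulr0.
under eq_bigr do rewrite (visit_prob0 hG).
have [Lz|zL'] := ltP L z.
  have [j0 hj] : exists j, lev j = z by apply: (level_exists zL); rewrite Lz lexx.
  rewrite (bigD1 j0)//= hj eqxx mul1r big1 ?addr0// => j jj.
  by rewrite -hj (inj_eq (@level_inj L n)) (negbTE jj) mul0r.
rewrite [in RHS]/heat ltNge (le_trans zL' (LY a)) /= big1// => j _.
rewrite (_ : (lev j == z) = false) ?mul0r//; apply/eqP; rewrite /level; lia.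
Qed.
End Martingale.

(** * Scaled sums and geometric series over the integers *)

Section MoreSums.
Variable R : realType.

Lemma abs_sum_to_scale (I : choiceType) (c : R[i]) (x : I -> R[i]) s :
  abs_sum_to x s -> abs_sum_to (fun i => c * x i) (c * s).
Proof.
move=> xs.
have cs : abs_sum_to (fun _ : unit => c) c.
  have := @abs_sum_to_finite R _ [fset tt]%fset (fun _ : unit => c).
  rewrite big_seq_fset1; apply => -[]; by rewrite inE.
have fibE (ti : unit * I) i : (ti \in [fset (tt, i)]%fset) = (ti.2 == i).
  by case: ti => -[] j; rewrite inE xpair_eqE.
have := abs_sum_to_fibers fibE (abs_sum_to_mul cs xs).
by congr abs_sum_to; apply/funext => i; rewrite big_seq_fset1.
Qed.

(** The double geometric series at [(p, 0)], regrouped by total degree: powers of [0] leave one term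
    in each fibre. *)
Lemma abs_sum_to_geometric_int (p : R[i]) (U : int) : normc p < 1 ->
  abs_sum_to (fun z : int => if U < z then p ^+ absz (z - U - 1)%R else 0) (1 - p)^-1.
Proof.
move=> p1.
have [box boxE] := fset_segments.
pose h (jk : nat * nat) : int := U + 1 + (jk.1 + jk.2)%N%:Z.
pose m (z : int) := absz (z - U - 1)%R.
pose fib (z : int) : {fset nat * nat} :=
  [fset jk in box (m z) `*` box (m z) | h jk == z]%fset.
have fibE jk z : (jk \in fib z) = (h jk == z).
  rewrite !inE !boxE andb_idl// => /eqP <-.
  rewrite /m (_ : h jk - U - 1 = (jk.1 + jk.2)%N%:Z) ?leq_addr ?leq_addl//.
  by rewrite /h; ring.
have p01 : normc p + normc (0 : R[i]) < 1 by rewrite normc0 addr0.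
have := abs_sum_to_fibers fibE (abs_sum_to_geometric2 p01).
rewrite subr0; congr abs_sum_to; apply/funext => z; case: ifPn => [Uz|zU]; last first.
  rewrite big_seq big1// => jk; rewrite fibE /h => /eqP; lia.
have mz : (m z, 0%N) \in fib z by rewrite fibE /h /m /=; apply/eqP; lia.
rewrite (big_fsetD1 _ mz) /= bin0 mulr1n expr0 mulr1 big_seq big1 ?addr0// => -[j k].
rewrite in_fsetD1 fibE xpair_eqE /h /= => /andP[ne /eqP hz].
by case: k ne hz => [|k] ne hz; [move: ne; rewrite /m; lia|rewrite expr0n mulr0 mul0rn].
Qed.
End MoreSums.

(** * Contour integrals of the payoff *)

Section ContourPayoff.
Variables (R : realType) (r : R).
Hypotheses (r0 : 0 < r) (r1 : r < 1).

Lemma ccirc_eq (f g : R[i] -> R[i]) : (forall t, f (circ r t) = g (circ r t)) ->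
  ccirc r f -> ccirc r g.
Proof. by move=> fg; rewrite /ccirc; under [X in ccontinuous X -> _]funext do rewrite fg. Qed.

Lemma ccirc_sum I (s : seq I) (F : I -> R[i] -> R[i]) : (forall i, ccirc r (F i)) ->
  ccirc r (fun v => \sum_(i <- s) F i v).
Proof.
move=> cF; elim: s => [|i s ih].
  by apply: ccirc_eq (ccirc_cst r 0) => t; rewrite big_nil.
by apply: ccirc_eq (ccircD (cF i) ih) => t; rewrite big_cons.
Qed.

Lemma contour_sum I (s : seq I) (F : I -> R[i] -> R[i]) : (forall i, ccirc r (F i)) ->
  contour r (fun v => \sum_(i <- s) F i v) = \sum_(i <- s) contour r (F i).
Proof.
move=> cF; elim: s => [|i s ih].
  rewrite big_nil (@eq_contour _ _ _ (fun v => 0 * 1)); last by move=> t; rewrite big_nil mul0r.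
  by rewrite contourZ ?mul0r//; exact: ccirc_cst.
rewrite big_cons -ih -contourD//; last exact: ccirc_sum.
by apply: eq_contour => t; rewrite big_cons.
Qed.

Let payoff_circ (a m : nat) (y x : int) t (v := circ r t) :
  (2 ^ x)^-1 * (-1) ^+ m * (v ^ (- (a.+1%:Z - m%:Z)) * (v + 1) ^ (y + a%:Z - x - m%:Z)) =
  v ^ (- a.+1%:Z) * (v + 1) ^ (y + a.+1%:Z) * payoff_at v m x.
Proof.
have v0 : v != 0 := circ_neq0 r0 t.
have w0 : v + 1 != 0 := circD1_neq0 r0 r1 t.
have two0 : (2 : R[i]) != 0 by rewrite pnatr_eq0.
rewrite /payoff_at (_ : 2 * v + 2 = 2 * (v + 1)); last by rewrite mulrDr mulr1.
have XD (x1 x2 : int) : (v + 1) ^ (x1 + x2) = (v + 1) ^ x1 * (v + 1) ^ x2.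
  exact: expfzDr.
have -> : (2 * (v + 1)) ^ (x + 1) = 2 ^ x * 2 * ((v + 1) ^ x * (v + 1)).
  by rewrite exprzMl ?unitfE// expfzDr// XD !expr1z.
have -> : (- v / (v + 1)) ^+ m = (-1) ^+ m * v ^+ m / (v + 1) ^+ m.
  by rewrite -(mulN1r v) !exprMn exprVn.
have -> : v ^ (- (a.+1%:Z - m%:Z)) = (v ^+ a.+1)^-1 * v ^+ m.
  by rewrite opprB addrC expfzDr// -exprnN.
have -> : (v + 1) ^ (y + a%:Z - x - m%:Z) =
    (v + 1) ^ y * (v + 1) ^+ a * ((v + 1) ^ x)^-1 * ((v + 1) ^+ m)^-1.
  by rewrite !XD -invr_expz -exprnN.
have -> : (v + 1) ^ (y + a.+1%:Z) = (v + 1) ^ y * ((v + 1) ^+ a * (v + 1)).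
  by rewrite XD -exprSr.
rewrite -exprnN.
have wx : (v + 1) ^ x != 0 by rewrite expfz_neq0.
have tx : (2 : R[i]) ^ x != 0 by rewrite expfz_neq0.
have va : v ^+ a.+1 != 0 by rewrite expf_neq0.
have wm : (v + 1) ^+ m != 0 by rewrite expf_neq0.
clear XD; move: ((v + 1) ^ x) ((2 : R[i]) ^ x) (v ^+ a.+1) ((v + 1) ^+ m)
  ((v + 1) ^ y) ((v + 1) ^+ a)
  ((-1) ^+ m) (v ^+ m) wx tx va wm w0 two0.
move: (v + 1) => w X A B C D E F H wx tx va wm w0 two0.
by field; rewrite wx tx va wm w0.
Qed.

Lemma ccirc_payoff (a m : nat) (y x : int) :
  ccirc r (fun v => v ^ (- a.+1%:Z) * (v + 1) ^ (y + a.+1%:Z) * payoff_at v m x).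
Proof.
apply: (@ccirc_eq (fun v => (2 ^ x)^-1 * (-1) ^+ m *
  (v ^ (- (a.+1%:Z - m%:Z)) * (v + 1) ^ (y + a%:Z - x - m%:Z)))).
  by move=> t; rewrite payoff_circ.
by apply: ccircM; [exact: ccirc_cst|exact: ccirc_res].
Qed.

Lemma contour_payoff (a m : nat) (y x : int) :
  contour r (fun v => v ^ (- a.+1%:Z) * (v + 1) ^ (y + a.+1%:Z) * payoff_at v m x) =
  (2 ^ x)^-1 * (-1) ^+ m * res r (a.+1%:Z - m%:Z) (y + a%:Z - x - m%:Z).
Proof.
rewrite -contourZ; last exact: ccirc_res.
by apply: eq_contour => t; rewrite payoff_circ.
Qed.

(** For [m > a] the factor [v^m] removes the pole. For [m <= a] monotonicity gives [x > Y m >= Y a],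
    so [res_binN] applies with a natural lower parameter, and its sign joins [(-1)^m] to give
    [(-1)^a]. *)
Lemma contour_payoff_heat N (Y : 'I_N -> int) (a m : 'I_N) x :
  (forall i j : 'I_N, (i < j)%N -> Y j < Y i) -> Y m < x ->
  contour r (fun v => v ^ (- a.+1%:Z) * (v + 1) ^ (Y a + a.+1%:Z) * payoff_at v m x) =
  (-1) ^+ a * ((m <= a)%N%:R * (heat Y a m x : R))%:C.
Proof.
move=> hY Yx; rewrite contour_payoff; case: (leqP m a) => ma; last first.
  rewrite (_ : a.+1%:Z - m%:Z = - (m - a.+1)%N%:Z); last by lia.
  by rewrite res_le0// mul0r mulr0 mulr0.
have Yax : Y a < x.
  move: ma; rewrite leq_eqVlt => /orP[/eqP/val_inj <- //|/hY Yam].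
  exact: lt_trans Yx.
rewrite /heat Yax (_ : a.+1%:Z - m%:Z = (a - m).+1%:Z); last by lia.
rewrite (_ : Y a + a%:Z - x - m%:Z = (a - m)%N%:Z - (absz (x - Y a - 1)%R)%:Z - 1); last by lia.
rewrite res_binN// mul1r rmorphM /= rmorph_nat.
have -> : (-1) ^+ a = (-1) ^+ (a - m) * (-1) ^+ m :> R[i] by rewrite -exprD subnK.
have -> : ((2 ^ x)^-1 : R)%:C = (2 ^ x)^-1 :> R[i].
  by rewrite fmorphV fmorphXz /= rmorph_nat.
ring.
Qed.
End ContourPayoff.

(** * The closed form *)

Section ClosedForm.
Context {R : realType} {d : measure_display} {T : measurableType d}.
Variables (N : nat) (Y : 'I_N -> int).
Hypothesis hY : forall i j : 'I_N, (i < j)%N -> Y j < Y i.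
Variables (P : int -> probability T R) (G : nat -> T -> int).
Hypothesis hG : forall z : int, geometric_walk (P z) G z.
Variables (L U : int) (J : nat) (o : 'I_N).
Hypotheses (o0 : o = 0%N :> nat) (UE : U = Y o) (UL : U = L + J%:Z)
  (LY : forall m, L <= Y m).

Local Notation lev := (@level L _).

Let YU m : Y m <= U.
Proof.
rewrite UE; case: (posnP m) => [m0|]; last by rewrite -{1}o0 => /hY/ltW.
by rewrite (_ : m = o)//; exact: val_inj (etrans m0 (esym o0)).
Qed.

(** The window size [n] is free: any [n] with [z <= L + n] gives the expectation from [z], so
    starting points above [U] are covered too. *)
Definition hit_expectation n (z : int) (v : R[i]) : R[i] :=
  \sum_(m < N) \sum_(j < n) payoff_at v m (lev j) * (Y m < lev j)%R%:R *
    (visit_prob (P z) G Y m (lev j))%:C.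

Let expectationE n z v : z <= L + n%:Z ->
  cexpectation (P z) (ch_payoff Y G v) = hit_expectation n z v.
Proof. by move=> zL; have [] := ch_payoff_expectation (hG z) zL v LY. Qed.

(** A walk started above [y_1] hits at time 0, so no later time is reached without an earlier
    hit. *)
Lemma visit_prob_above z m x : U < z -> (0 < m < N)%N -> L < x -> visit_prob (P z) G Y m x = 0.
Proof.
move=> Uz; have zL : z <= L + (absz (z - L)%R)%:Z by lia.
elim: m x => // m ih x /= mN Lx.
rewrite (@visit_prob_rec _ _ _ _ _ _ (hG z) _ _ _ _ zL (Ordinal (ltnW mN)))//.
rewrite big1// => j _ /=; have Lj : L < lev j by rewrite /level ltrDl.
case: m ih mN => [|m] ih mN; last by rewrite ih ?mulr0// (ltnW mN).
rewrite (visit_prob0 (hG z)); case: eqP => [->|]; last by rewrite !mulr0.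
rewrite leNgt (_ : _ < z) ?mul0r//.
by apply: le_lt_trans Uz.
Qed.

Lemma expectation_above z v : U < z ->
  cexpectation (P z) (ch_payoff Y G v) = payoff_at v 0 z.
Proof.
move=> Uz; pose n := absz (z - L)%R; have zL : z <= L + n%:Z by rewrite /n; lia.
rewrite (expectationE v zL) /hit_expectation (bigD1 o)//= [X in _ + X]big1 ?addr0; last first.
  move=> m mo; rewrite big1// => j _; rewrite visit_prob_above ?mulr0//.
    rewrite ltn_ord andbT lt0n; apply: contra_neq mo => m0.
    by exact: val_inj (etrans m0 (esym o0)).
  by rewrite /level ltrDl.
have [j0 hj] : exists j : 'I_n, level L j = z.
  by apply: (level_exists zL); rewrite lexx andbT; lia.
rewrite (bigD1 j0)//= [X in _ + X]big1 ?addr0; last first.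
  move=> j jj; rewrite o0 (visit_prob0 (hG z)) -{1}hj (inj_eq (@level_inj L n)) (negbTE jj).
  by rewrite mulr0.
by rewrite hj o0 (visit_prob0 (hG z)) eqxx -UE Uz !mulr1.
Qed.

Lemma expectation_below z v : z <= L -> cexpectation (P z) (ch_payoff Y G v) = 0.
Proof.
move=> zL; rewrite (@expectationE 0) ?addr0// /hit_expectation big1// => m _.
by rewrite big_ord0.
Qed.

Definition ch_closed (v u : R[i]) : R[i] :=
  \sum_(j < J) (2 * u + 2) ^ lev j * hit_expectation J (lev j) v +
  (u + 1) ^ (U + 1) * (v + 1) ^ (- (U + 1)) * (v - u)^-1.

Lemma ch_domainP (v u : R[i]) : ch_domain (v, u) ->
  [/\ normc v < 2^-1, normc (u + 1) < 2^-1 & u + 1 != 0].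
Proof.
have h2 : (2^-1 : R[i]) = (2^-1 : R)%:C by rewrite fmorphV rmorph_nat.
rewrite /ch_domain /OmegaR /OmegaL => -[] /=; rewrite h2 !normE !ltcR => -> [-> /eqP u1].
by split=> //; rewrite addr_eq0.
Qed.

Lemma normc_D1_gt (v : R[i]) : normc v < 2^-1 -> 2^-1 < normc (v + 1).
Proof.
move=> v2; have := le_normcD (v + 1) (- v).
by rewrite normcN addrAC subrr add0r normc1; lra.
Qed.

Lemma normc_gt (u : R[i]) : normc (u + 1) < 2^-1 -> 2^-1 < normc u.
Proof.
move=> u2; have := le_normcD (u + 1) (- u).
by rewrite normcN addrAC subrr add0r normc1; lra.
Qed.

Lemma normc_neq0 (w : R[i]) : 0 < normc w -> w != 0.
Proof. by move=> h; apply/eqP => w0; move: h; rewrite w0 normc0 ltxx. Qed.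

(** Cut the sum at [U]. Below, only the finitely many levels above [L] contribute; above, the terms
    are geometric with ratio [(u + 1) / (v + 1)], of modulus below 1 since
    [|u + 1| < 1/2 < |v + 1|]. *)
Lemma ch_term_sum (v u : R[i]) : ch_domain (v, u) -> abs_sum_to (ch_term Y P G v u) (ch_closed v u).
Proof.
move=> /ch_domainP[v2 u2 u10]; have v12 := normc_D1_gt v2; have uu2 := normc_gt u2.
have v10 : v + 1 != 0 by apply: normc_neq0; lra.
have vu0 : v - u != 0.
  by rewrite subr_eq0; apply/eqP => h; move: v2; rewrite h; lra.
have two0 : (2 : R[i]) != 0 by rewrite pnatr_eq0.
pose p := (u + 1) / (v + 1).
have p1 : normc p < 1.
  by rewrite /p normcM normcV ltr_pdivrMr; lra.
(* The additional [(v + 1)^-1] turns [(1 - p)^-1 = (v + 1) / (v - u)] into [(v - u)^-1]. *)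
pose c := (u + 1) ^ (U + 1) * (v + 1) ^ (- (U + 1)) * (v + 1)^-1.
have tail := abs_sum_to_scale c (abs_sum_to_geometric_int U p1).
pose A := [fset lev j | j : 'I_J]%fset.
pose hd z := if z <= U then ch_term Y P G v u z else 0.
have hdA z : z \notin A -> hd z = 0.
  rewrite /hd; case: ifP => // zU zA; rewrite /ch_term expectation_below ?mulr0//.
  rewrite leNgt; apply/negP => Lz; move/negP: zA; apply.
  have zJ : z <= L + J%:Z by rewrite -UL.
  have [j <-] : exists j : 'I_J, lev j = z by apply: (level_exists zJ); rewrite Lz lexx.
  exact: in_imfset.
have := abs_sum_to_add (abs_sum_to_finite hdA) tail.
have -> : \sum_(i <- A) hd i + c * (1 - p)^-1 = ch_closed v u.
  rewrite /ch_closed; congr (_ + _).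
    rewrite big_imfset /=; last by move=> i j _ _; exact: level_inj.
    rewrite big_enum /=; apply: eq_bigr => j _.
    have jU : lev j <= U by rewrite UL /level lerD2l lez_nat.
    by rewrite /hd jU /ch_term (@expectationE J)// -UL.
  rewrite /c /p -mulrA; congr (_ * _).
  by have := v10; have := vu0 => h1 h2; field; rewrite h1 h2.
congr abs_sum_to; apply/funext => z; rewrite /hd leNgt.
case: (ltP U z) => Uz /=; last by rewrite mulr0 addr0.
rewrite add0r /ch_term expectation_above// /payoff_at expr0 mulr1.
have tE w : 2 * w + 2 = 2 * (w + 1) :> R[i] by rewrite mulrDr mulr1.
rewrite !tE !exprzMl ?unitfE// /c /p.
pose k := absz (z - U - 1)%R.
have zE : z = U + 1 + k%:Z by rewrite /k; lia.
rewrite -/k zE !expfzDr//.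
rewrite exprMn exprVn -invr_expz expfzDr// !expr1z -!exprnP.
have tU : (2 : R[i]) ^ U != 0 by rewrite expfz_neq0.
have vU : (v + 1) ^ U != 0 by rewrite expfz_neq0.
have tk : (2 : R[i]) ^+ k != 0 by rewrite expf_neq0.
have vk : (v + 1) ^+ k != 0 by rewrite expf_neq0.
move: ((u + 1) ^ U) ((v + 1) ^ U) ((2 : R[i]) ^ U) ((2 : R[i]) ^+ k) ((u + 1) ^+ k)
  ((v + 1) ^+ k) tU vU tk vk.
move: (u + 1) (v + 1) v10 => x y y0 A1 A2 A3 A4 A5 A6 h1 h2 h3 h4.
by field; rewrite y0 h1 h2 h3 h4.
Qed.

Lemma open_bidisc (v0 u0 : R[i]) : ch_domain (v0, u0) -> exists e : R, 0 < e /\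
  forall v u : R[i], `|v - v0| < e%:C -> `|u - u0| < e%:C -> ch_domain (v, u).
Proof.
move=> /ch_domainP[v2 u2 u10].
have nu : 0 < normc (u0 + 1).
  by rewrite lt_neqAle normc_ge0 eq_sym andbT; apply: contra_neq u10 => /eq0_normc.
(* The distances to the circle [|v| = 1/2], to the circle [|u + 1| = 1/2] and to the puncture
   [u = -1]. *)
exists (Num.min (2^-1 - normc v0) (Num.min (2^-1 - normc (u0 + 1)) (normc (u0 + 1)))).
rewrite !lt_min !subr_gt0 v2 u2 nu; split=> // v u.
rewrite !normE !ltcR !lt_min => /andP[hv _] /andP[_ /andP[hu hu']].
have h2 : (2^-1 : R[i]) = (2^-1 : R)%:C by rewrite fmorphV rmorph_nat.
rewrite /ch_domain /OmegaR /OmegaL; split; rewrite /= ?h2 ?normE ?ltcR.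
  by have := le_normcD (v - v0) v0; rewrite subrK; lra.
split.
  by have := le_normcD (u - u0) (u0 + 1); rewrite addrA subrK; lra.
move=> uE; move: hu'; rewrite uE -opprD normcN addrC ltxx//.
Qed.

Lemma analytic_ch_closed (v0 u0 : R[i]) : ch_domain (v0, u0) -> analytic2_at ch_closed v0 u0.
Proof.
move=> /ch_domainP[v2 u2 u10]; have v12 := normc_D1_gt v2; have uu2 := normc_gt u2.
have v10 : v0 + 1 != 0 by apply: normc_neq0; lra.
have vu0 : v0 - u0 != 0.
  by rewrite subr_eq0; apply/eqP => h; move: v2; rewrite h; lra.
(* Every factor of the closed form is reduced to an integer power of an affine function that does
   not vanish at the centre. *)
have aff (c x y : R[i]) (k : int) : c + x * v0 + y * u0 != 0 ->
    analytic2_at (fun v u => (c + x * v + y * u) ^ k) v0 u0.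
  move=> h; apply: analytic2_at_exprz; first exact: analytic2_at_affine.
  exact: analytic2_at_inv_affine.
have ext f g : (forall v u, f v u = g v u) -> analytic2_at f v0 u0 -> analytic2_at g v0 u0.
  by move=> fg; apply: (analytic2_at_ext ltr01) => v u _ _.
have two0 : (2 : R[i]) != 0 by rewrite pnatr_eq0.
have aV k : analytic2_at (fun v _ => (v + 1) ^ k) v0 u0.
  apply: ext (aff 1 1 0 k _) => [v u|]; first by rewrite mul1r mul0r addr0 addrC.
  by rewrite mul1r mul0r addr0 addrC.
have aU k : analytic2_at (fun _ u => (u + 1) ^ k) v0 u0.
  apply: ext (aff 1 0 1 k _) => [v u|]; first by rewrite mul1r mul0r addr0 addrC.
  by rewrite mul1r mul0r addr0 addrC.
have a2V k : analytic2_at (fun v _ => (2 * v + 2) ^ k) v0 u0.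
  apply: ext (aff 2 2 0 k _) => [v u|]; first by rewrite mul0r addr0 addrC.
  by rewrite mul0r addr0 -{1}(mulr1 2) -mulrDr mulf_neq0// addrC.
have a2U k : analytic2_at (fun _ u => (2 * u + 2) ^ k) v0 u0.
  apply: ext (aff 2 0 2 k _) => [v u|]; first by rewrite mul0r addr0 addrC.
  by rewrite mul0r addr0 -{1}(mulr1 2) -mulrDr mulf_neq0// addrC.
have aVU : analytic2_at (fun v u => (v - u)^-1) v0 u0.
  apply: ext (aff 0 1 (-1) (-1) _) => [v u|]; first by rewrite mul1r mulN1r add0r exprN1.
  by rewrite mul1r mulN1r add0r.
have aPay m x : analytic2_at (fun v _ => payoff_at v m x) v0 u0.
  apply: (@ext (fun v u => 2 * (2 * v + 2) ^ (- (x + 1)) * ((-1 * v) * (v + 1) ^ (-1)) ^+ m)).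
    by move=> v u; rewrite mulN1r exprN1 -invr_expz.
  apply: analytic2_at_mul.
    by apply: analytic2_at_mul; [exact: analytic2_at_cst|exact: a2V].
  apply: analytic2_at_exprn; apply: analytic2_at_mul; last exact: aV.
  by apply: ext (analytic2_at_affine 0 (-1) 0 v0 u0) => v u; rewrite add0r mul0r addr0.
apply: analytic2_at_add.
  apply: analytic2_at_sum => j; apply: analytic2_at_mul; first exact: a2U.
  apply: analytic2_at_sum => m; apply: analytic2_at_sum => k.
  apply: analytic2_at_mul; last exact: analytic2_at_cst.
  by apply: analytic2_at_mul; [exact: aPay|exact: analytic2_at_cst].
apply: analytic2_at_mul => //; apply: analytic2_at_mul; [exact: aU|exact: aV].
Qed.

(** * The contour identity for the closed form *)

Section Contour.
Variables (a : 'I_N) (r : R) (u : R[i]).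
Hypotheses (r0 : 0 < r) (r2 : r < 2^-1) (u2 : normc (u + 1) < 2^-1) (u10 : u + 1 != 0).

Local Notation W := (fun v : R[i] => v ^ (- a.+1%:Z) * (v + 1) ^ (Y a + a.+1%:Z)).

Let r1 : r < 1. Proof. by apply: lt_trans r2 _; rewrite invf_lt1 ?ltr1n. Qed.

Let ru : r < normc u. Proof. exact: lt_trans r2 (normc_gt u2). Qed.

Lemma ccirc_hit_expectation n z : ccirc r (fun v => W v * hit_expectation n z v).
Proof.
apply: (@ccirc_eq _ _ (fun v => \sum_(m < N) \sum_(j < n)
  ((Y m < lev j)%R%:R * (visit_prob (P z) G Y m (lev j))%:C) * (W v * payoff_at v m (lev j)))).
  move=> t; rewrite /hit_expectation mulr_sumr; apply: eq_bigr => m _.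
  by rewrite mulr_sumr; apply: eq_bigr => j _; ring.
apply: ccirc_sum => m; apply: ccirc_sum => j; apply: ccircM; first exact: ccirc_cst.
exact: ccirc_payoff.
Qed.

Lemma contour_hit_expectation n z : z <= L + n%:Z ->
  contour r (fun v => W v * hit_expectation n z v) = (-1) ^+ a * (heat Y a 0 z : R)%:C.
Proof.
move=> zL; rewrite (@eq_contour _ _ _ (fun v => \sum_(m < N) \sum_(j < n)
  ((Y m < lev j)%R%:R * (visit_prob (P z) G Y m (lev j))%:C) * (W v * payoff_at v m (lev j)))).
  have cF m j : ccirc r (fun v => ((Y m < lev j)%R%:R *
      (visit_prob (P z) G Y m (lev j))%:C) * (W v * payoff_at v m (lev j))).
    by apply: ccircM; [exact: ccirc_cst|exact: ccirc_payoff].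
  rewrite contour_sum; last by move=> m; apply: ccirc_sum => j; exact: cF.
  rewrite -(heat_sum (hG z) a zL LY) !rmorph_sum mulr_sumr; apply: eq_bigr => m _ /=.
  rewrite contour_sum; last exact: cF.
  rewrite rmorph_sum mulr_sumr; apply: eq_bigr => j _ /=.
  rewrite contourZ; last exact: ccirc_payoff.
  have [Yj|Yj] := boolP (Y m < lev j); last by rewrite andbF !mul0r mulr0.
  rewrite andbT (contour_payoff_heat r0 r1 _ hY Yj) mul1r mulrCA.
  by rewrite -(rmorphM (real_complex R)) /= mulrCA.
move=> t; rewrite /hit_expectation mulr_sumr; apply: eq_bigr => m _.
by rewrite mulr_sumr; apply: eq_bigr => j _; ring.
Qed.

(** The powers of 2 cancel and levels up to [Y a] drop out. Reindexed from [Y a + 1], the sum is the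
    one subtracted in [resu_telescope] with [n = U - Y a]. *)
Lemma sum_heat : \sum_(j < J) (2 * u + 2) ^ lev j * ((-1) ^+ a * (heat Y a 0 (lev j) : R)%:C) =
  \sum_(j < absz (U - Y a)%R) (u + 1) ^ (Y a + 1 + j%:Z) * ((-1) ^+ a * 'C(j, a)%:R).
Proof.
pose e := absz (Y a - L)%R.
have Ye : Y a = L + e%:Z by have := LY a; rewrite /e; lia.
have Je : J = (e + absz (U - Y a)%R)%N by have := YU a; have := LY a; rewrite /e; lia.
move: (absz (U - Y a)%R) Je => n Je.
pose F k : R[i] := (2 * u + 2) ^ (L + k.+1%:Z) * ((-1) ^+ a * (heat Y a 0 (L + k.+1%:Z) : R)%:C).
rewrite (eq_bigr (fun j : 'I_J => F j))// Je big_split_ord /= big1 ?add0r; last first.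
  move=> i _; rewrite /F /heat (_ : (Y a < _) = false) ?mulr0//.
  by rewrite Ye; have := ltn_ord i; lia.
apply: eq_bigr => j _; rewrite /F /heat.
have -> : L + (e + j).+1%:Z = Y a + 1 + j%:Z by rewrite Ye; lia.
rewrite (_ : Y a < _ = true); last by lia.
have -> : absz (Y a + 1 + j%:Z - Y a - 1)%R = j by lia.
have -> : 2 * u + 2 = 2 * (u + 1) by rewrite mulrDr mulr1.
have two0 : (2 : R[i]) != 0 by rewrite pnatr_eq0.
rewrite exprzMl ?unitfE// subn0 rmorphM /= fmorphV fmorphXz /= !rmorph_nat.
have tx : (2 : R[i]) ^ (Y a + 1 + j%:Z) != 0 by rewrite expfz_neq0.
move: ((2 : R[i]) ^ _) ((u + 1) ^ _) ((-1) ^+ a) ('C(j, a)%:R : R[i]) tx.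
by move=> A B D E A0; field.
Qed.

(** In the tail [W] absorbs [(v + 1)^(-(U+1))], leaving exponent [a - n] and hence the left side of
    [resu_telescope]. The sum it subtracts cancels the head by [sum_heat]. *)
Lemma contour_ch_closed : contour r (fun v => W v * ch_closed v u) =
  - (u ^ (- a.+1%:Z) * (u + 1) ^ (Y a + a.+1%:Z)).
Proof.
pose n := absz (U - Y a)%R.
have nE : U = Y a + n%:Z by have := YU a; rewrite /n; lia.
have cH j : ccirc r (fun v => (2 * u + 2) ^ lev j * (W v * hit_expectation J (lev j) v)).
  by apply: ccircM; [exact: ccirc_cst|exact: ccirc_hit_expectation].
have cT : ccirc r (fun v => (u + 1) ^ (U + 1) *
    (v ^ (- a.+1%:Z) * (v + 1) ^ (a%:Z - n%:Z) / (v - u))).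
  by apply: ccircM; [exact: ccirc_cst|exact: ccirc_resu].
rewrite (@eq_contour _ _ _ (fun v =>
  \sum_(j < J) (2 * u + 2) ^ lev j * (W v * hit_expectation J (lev j) v) +
  (u + 1) ^ (U + 1) * (v ^ (- a.+1%:Z) * (v + 1) ^ (a%:Z - n%:Z) / (v - u)))).
  rewrite contourD//; last exact: ccirc_sum.
  rewrite contour_sum// contourZ; last exact: ccirc_resu.
  rewrite -/(resu _ _ _ _) nE -addrA [n%:Z + 1]addrC addrA resu_telescope//.
  rewrite -sum_heat addrC -addrA -[RHS]addr0; congr (_ + _).
  rewrite addrC; apply/eqP; rewrite subr_eq0; apply/eqP; apply: eq_bigr => j _.
  rewrite contourZ; last exact: ccirc_hit_expectation.
  by rewrite contour_hit_expectation// -UL UL /level lerD2l lez_nat.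
move=> t; rewrite /ch_closed mulrDr mulr_sumr; congr (_ + _).
  by apply: eq_bigr => j _; rewrite mulrCA.
have w0 := circD1_neq0 r0 r1 t.
have -> : a%:Z - n%:Z = (Y a + a.+1%:Z) + - (U + 1) by rewrite nE; lia.
rewrite (expfzDr (Y a + a.+1%:Z) (- (U + 1)) w0) !mulrA; congr (_ * _ * _).
by rewrite mulrC mulrA.
Qed.
End Contour.
End ClosedForm.

Theorem theorem3p4 (R : realType) (N : nat) (hN : (0 < N)%N)
    (Y : 'I_N -> int) (hY : forall i j : 'I_N, (i < j)%N -> Y j < Y i)
    (d : measure_display) (T : measurableType d)
    (P : int -> probability T R) (G : nat -> T -> int)
    (hG : forall z : int, geometric_walk (P z) G z) :
  (forall v u : R[i], ch_domain (v, u) ->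
     (forall z : int, cintegrable (P z) (ch_payoff Y G v)) /\
     csummable (ch_term Y P G v u)) /\
  characteristic_function Y (ch_walk Y P G).
Proof.
case: N hN Y hY => // N' _ Y hY.
pose U := Y ord0; pose L := Y ord_max; pose J := absz (U - L)%R.
have anti (i j : 'I_N'.+1) : (i <= j)%N -> Y j <= Y i.
  by rewrite leq_eqVlt => /orP[/eqP/val_inj -> //|/hY/ltW].
have LY m : L <= Y m by apply: anti; rewrite -ltnS.
have UL : U = L + J%:Z by have := LY ord0; rewrite /J -/U; lia.
have termS v u : ch_domain (v, u) -> abs_sum_to (ch_term Y P G v u) (ch_closed Y P G L U J v u).
  exact: (@ch_term_sum _ _ _ _ _ hY _ _ hG _ _ _ ord0).
have walkE v u : ch_domain (v, u) -> ch_walk Y P G v u = ch_closed Y P G L U J v u.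
  by move=> /termS[_ /csum_eq].
split.
  move=> v u D; split; last by exists (ch_closed Y P G L U J v u); exact: (termS _ _ D).2.
  move=> z; have zL : z <= L + (absz (z - L)%R)%:Z by lia.
  by have [] := ch_payoff_expectation (hG z) zL v LY.
split.
  move=> v0 u0 D.
  (* [ch_walk] agrees with the closed form on the domain only, so the expansion is transferred
     inside a bidisc contained in it. *)
  have [e [e0 De]] := open_bidisc D.
  have [b [s [s0 h]]] : analytic2_at (ch_walk Y P G) v0 u0.
    apply: (analytic2_at_ext e0 _ (analytic_ch_closed Y P G L U J D)) => v u hv hu.
    by rewrite walkE//; exact: De.
  by exists b, s; split=> // v u hv hu; exact: (h v u hv hu).2.
move=> a u uL u1 r /andP[r0 r2].
(* The point [v = 0] is a placeholder that lets [ch_domainP] deliver the bounds on [u]. *)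
have [_ u2 u10] : [/\ normc (0 : R[i]) < 2^-1, normc (u + 1) < 2^-1 & u + 1 != 0].
  apply: ch_domainP; split; last by split=> //; apply/eqP.
  by rewrite /OmegaR /= normr0 invr_gt0 ltr0n.
rewrite -(@contour_ch_closed _ _ _ _ _ hY P G hG L U J ord0 erefl erefl UL LY a r u r0 r2 u2 u10).
apply: eq_contour => t; rewrite walkE//; split; last by split=> //; apply/eqP.
have h2 : (2^-1 : R[i]) = (2^-1 : R)%:C by rewrite fmorphV rmorph_nat.
by rewrite /OmegaR /= h2 normE normc_circ// ltcR.
Qed.
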